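(* Let $K$ be a commutative associative $F$-algebra, regarded as an algebra with the trivial involution. Let $N_{\mathcal{V}}:\mathcal{V}\to K$ be a cubic form on a $K$-module $\mathcal{V}$ and let $T:\mathcal{V}\times\mathcal{V}\to K$ be a nondegenerate symmetric $K$-bilinear form such that $(T,N_{\mathcal{V}})$ satisfies the adjoint identity. Denote the adjoint of $(T,N_{\mathcal{V}})$ by $\#$ and the linearization of $\#$ by $\times$, i.e. $u\times v=(u+v)^\#-u^\#-v^\#$. Form the commutative algebra $\mathcal{J}=\mathcal{A}(T,N_{\mathcal{V}})=K\oplus\mathcal{V}$ (with trivial involution) and define $\theta:\mathcal{J}\to\mathcal{J}$ by $(\alpha+v)^\theta=\alpha-v$ for $\alpha\in K$, $v\in\mathcal{V}$. Also let $\mu\in K^\times$, form $\mathcal{E}=K[s_0]$ (free over $K$ with basis $1,s_0$) with $s_0^2=\mu$ and $K$-linear involution $*$ with $s_0^*=-s_0$, and form the left $\mathcal{E}$-module $\mathcal{W}=\mathcal{E}\otimes_K\mathcal{V}$ with $\mathcal{V}$ identified with $1\otimes\mathcal{V}$. Extend $T$ to a hermitian form $h:\mathcal{W}\times\mathcal{W}\to\mathcal{E}$, extend $\times$ to an $\mathcal{E}$-bi-semilinear map $\diamond:\mathcal{W}\times\mathcal{W}\to\mathcal{W}$, and set $w^\natural=\frac12w\diamond w$ and $N(w)=\frac16h(w,w\diamond w)$ for $w\in\mathcal{W}$. Then: (a) $h$ is nondegenerate, $N:\mathcal{W}\to\mathcal{E}$ is the unique cubic form over $\mathcal{E}$ extending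 $N_{\mathcal{V}}$, and $(h,N)$ satisfies the adjoint identity with adjoint $\natural$. (b) $\operatorname{CD}(\mathcal{J},\theta,\mu)=\mathcal{A}(h,N)$ as algebras with involution (under the identification $K\oplus\mathcal{V}\oplus s_0K\oplus s_0\mathcal{V}=\mathcal{E}\oplus\mathcal{W}$). (c) $\mathcal{Z}(\operatorname{CD}(\mathcal{J},\theta,\mu))=K$ and $\operatorname{CD}(\mathcal{J},\theta,\mu)$ is a structurable algebra.
   Context: $F$ is a field of characteristic $\ne 2,3$. ''Algebra'' means unital, not necessarily associative $F$-algebra; $[x,y]=xy-yx$, $(x,y,z)=(xy)z-x(yz)$. An algebra with involution is an algebra with an anti-automorphism $*$ of period 2 (the identity, called the trivial involution, is allowed on commutative algebras); $\mathcal{A}_+=\{x:x^*=x\}$; its centre is $\mathcal{Z}(\mathcal{A})=\{z\in\mathcal{A}_+:[z,\mathcal{A}]=(z,\mathcal{A},\mathcal{A})=(\mathcal{A},z,\mathcal{A})=(\mathcal{A},\mathcal{A},z)=0\}$. A structurable algebra is an algebra with involution satisfying $\{xy\{zwq\}\}-\{zw\{xyq\}\}=\{\{xyz\}wq\}-\{z\{yxw\}q\}$, where $\{xyz\}=(xy^* )z+(zy^* )x-(zx^* )y$. Let $\mathcal{E}$ be a commutative associative algebra with involution $*$ and $\mathcal{W}$ a left $\mathcal{E}$-module. A cubic form $N:\mathcal{W}\to\mathcal{E}$ over $\mathcal{E}$ is a map $N(x)=\frac16f(x,x,x)$ with $f:\mathcal{W}^3\to\mathcal{E}$ symmetric and $\mathcal{E}$-trilinear;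 $\partial_uN|_v=\frac12f(u,v,v)$. A hermitian form is a biadditive $h:\mathcal{W}\times\mathcal{W}\to\mathcal{E}$ with $h(au,v)=ah(u,v)$, $h(u,av)=a^*h(u,v)$, $h(v,u)=h(u,v)^*$; it is nondegenerate if $h(\mathcal{W},u)=0$ implies $u=0$. A product $\diamond$ is bi-semilinear if it is biadditive and $(au)\diamond v=u\diamond(av)=a^*(u\diamond v)$ for $a\in\mathcal{E}$. For $h$ nondegenerate, $(h,N)$ has an adjoint if for each $v$ there is $v^\natural\in\mathcal{W}$ (necessarily unique) with $\partial_uN|_v=h(u,v^\natural)$ for all $u$; then $u\diamond v:=(u+v)^\natural-u^\natural-v^\natural$. $(h,N)$ satisfies the adjoint identity if it has an adjoint and $(v^\natural)^\natural=N(v)v$ for all $v$. When $(h,N)$ has an adjoint, $\mathcal{A}(h,N)=\mathcal{E}\oplus\mathcal{W}$ is the algebra with involution with $(a,v)(b,w)=(ab+h(v,w),\,aw+b^*v+v\diamond w)$, $(a,v)^*=(a^*,v)$, with $(a,v)$ written $a+v$. These definitions apply in particular to $(T,N_{\mathcal{V}})$ over $K$ with the trivial involution (where $\natural,\diamond$ are written $\#,\times$). For a commutative algebra $\mathcal{J}$ over $K$, a $K$-linear map $\theta$ of $\mathcal{J}$ of period 2, and $\mu\in K^\times$ (units of $K$), $\operatorname{CD}(\mathcal{J},\theta,\mu)=\mathcal{J}\oplus s_0\mathcal{J}$ has product $(a+s_0b)(c+s_0d)=(ac+\mu(bd^\theta)^\theta)+s_0(a^\theta d+(b^\theta c^\theta)^\theta)$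 and involution $(a+s_0b)^*=a-s_0b^\theta$. *)

(* Defs.v *)
(* A commutative associative unital R-algebra S is presented by its structure
   map phi : {rmorphism R -> S}.  This keeps the tower F -> K -> E free of
   competing scalar actions and, with comPzRingType, does not exclude the zero
   algebra.  An S-module is an lmodType S. *)
From HB Require Import structures.
From mathcomp Require Import all_boot all_algebra.

Set Implicit Arguments.
Unset Strict Implicit.
Unset Printing Implicit Defensive.

Import GRing.Theory.
Local Open Scope ring_scope.

(* The operations of a not necessarily associative R-algebra with involution;
   the axioms are in [is_star_algebra]. *)
Record star_alg (R : pzRingType) := StarAlg {
  alg_sort :> zmodType;
  alg_scale : R -> alg_sort -> alg_sort;
  alg_mul : alg_sort -> alg_sort -> alg_sort;
  alg_one : alg_sort;
  alg_star : alg_sort -> alg_sort }.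

Arguments alg_scale {R s}.
Arguments alg_mul {R s}.
Arguments alg_one {R s}.
Arguments alg_star {R s}.

Definition is_star_algebra (R : pzRingType) (A : star_alg R) : Prop :=
  [/\ [/\ forall x : A, alg_scale 1 x = x,
          forall a b (x : A), alg_scale a (alg_scale b x) = alg_scale (a * b) x,
          forall a b (x : A),
            alg_scale (a + b) x = alg_scale a x + alg_scale b x
        & forall a (x y : A),
            alg_scale a (x + y) = alg_scale a x + alg_scale a y],
      [/\ forall x y z : A, alg_mul (x + y) z = alg_mul x z + alg_mul y z,
          forall x y z : A, alg_mul x (y + z) = alg_mul x y + alg_mul x z,
          forall a (x y : A),
            alg_mul (alg_scale a x) y = alg_scale a (alg_mul x y)
        & forall a (x y : A),
            alg_mul x (alg_scale a y) = alg_scale a (alg_mul x y)],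
      forall x : A, alg_mul alg_one x = x /\ alg_mul x alg_one = x
    & [/\ forall x y : A, alg_star (x + y) = alg_star x + alg_star y,
          forall a (x : A), alg_star (alg_scale a x) = alg_scale a (alg_star x),
          forall x y : A,
            alg_star (alg_mul x y) = alg_mul (alg_star y) (alg_star x)
        & involutive (@alg_star R A)]].

Definition restrict_scalars (R S : pzRingType) (phi : {rmorphism R -> S})
    (A : star_alg S) : star_alg R :=
  StarAlg (fun c (x : A) => alg_scale (phi c) x) alg_mul alg_one alg_star.

Definition alg_comm (R : pzRingType) (A : star_alg R) (x y : A) : A :=
  alg_mul x y - alg_mul y x.

Definition alg_assoc (R : pzRingType) (A : star_alg R) (x y z : A) : A :=
  alg_mul (alg_mul x y) z - alg_mul x (alg_mul y z).

Definition in_centre (R : pzRingType) (A : star_alg R) (z : A) : Prop :=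
  alg_star z = z /\
  forall x y : A, [/\ alg_comm z x = 0, alg_assoc z x y = 0,
                      alg_assoc x z y = 0 & alg_assoc x y z = 0].

Definition triple (R : pzRingType) (A : star_alg R) (x y z : A) : A :=
  alg_mul (alg_mul x (alg_star y)) z + alg_mul (alg_mul z (alg_star y)) x
  - alg_mul (alg_mul z (alg_star x)) y.

Definition structurable (R : pzRingType) (A : star_alg R) : Prop :=
  is_star_algebra A /\
  forall x y z w q : A,
    triple x y (triple z w q) - triple z w (triple x y q)
    = triple (triple x y z) w q - triple z (triple y x w) q.

Definition star_alg_iso (R : pzRingType) (A B : star_alg R) (f : A -> B) : Prop :=
  [/\ bijective f,
      forall x y, f (x + y) = f x + f y,
      forall c x, f (alg_scale c x) = alg_scale c (f x),
      forall x y, f (alg_mul x y) = alg_mul (f x) (f y)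
    & f alg_one = alg_one /\ forall x, f (alg_star x) = alg_star (f x)].

Definition symmetric_trilinear (E : comPzRingType) (W : lmodType E)
    (f : W -> W -> W -> E) : Prop :=
  [/\ forall x y z, f y x z = f x y z,
      forall x y z, f x z y = f x y z
    & forall a x x' y z, f (a *: x + x') y z = a * f x y z + f x' y z].

Definition cubic_form_of (F : fieldType) (E : comPzRingType)
    (phi : {rmorphism F -> E}) (W : lmodType E)
    (f : W -> W -> W -> E) (N : W -> E) : Prop :=
  symmetric_trilinear f /\ forall x, N x = phi (6%:R^-1) * f x x x.

Definition cubic_form (F : fieldType) (E : comPzRingType)
    (phi : {rmorphism F -> E}) (W : lmodType E) (N : W -> E) : Prop :=
  exists f, cubic_form_of phi f N.

Definition is_hermitian (E : comPzRingType) (star : E -> E) (W : lmodType E)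
    (h : W -> W -> E) : Prop :=
  [/\ forall u u' v, h (u + u') v = h u v + h u' v,
      forall u v v', h u (v + v') = h u v + h u v',
      forall a u v, h (a *: u) v = a * h u v,
      forall a u v, h u (a *: v) = star a * h u v
    & forall u v, h v u = star (h u v)].

Definition is_nondegenerate (E : comPzRingType) (W : lmodType E)
    (h : W -> W -> E) : Prop :=
  forall u, (forall w, h w u = 0) -> u = 0.

Definition bi_semilinear (E : comPzRingType) (star : E -> E) (W : lmodType E)
    (dm : W -> W -> W) : Prop :=
  [/\ forall u u' v, dm (u + u') v = dm u v + dm u' v,
      forall u v v', dm u (v + v') = dm u v + dm u v',
      forall a u v, dm (a *: u) v = star a *: dm u v
    & forall a u v, dm u (a *: v) = star a *: dm u v].

(* [phi (2%:R^-1) * f u v v] is the derivative of N at v in direction u; f is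
   determined by N since 6 is invertible in F. *)
Definition is_adjoint (F : fieldType) (E : comPzRingType)
    (phi : {rmorphism F -> E}) (W : lmodType E)
    (h : W -> W -> E) (N : W -> E) (natural : W -> W) : Prop :=
  exists2 f, cubic_form_of phi f N
           & forall u v, phi (2%:R^-1) * f u v v = h u (natural v).

Definition adjoint_identity (F : fieldType) (E : comPzRingType)
    (phi : {rmorphism F -> E}) (W : lmodType E)
    (h : W -> W -> E) (N : W -> E) (natural : W -> W) : Prop :=
  is_adjoint phi h N natural /\ forall v, natural (natural v) = N v *: v.

Definition linearize (W : zmodType) (natural : W -> W) (u v : W) : W :=
  natural (u + v) - natural u - natural v.

(* A(h, N) as an R-algebra, phi : R -> E being the structure map of E.  It
   depends on N only through the adjoint [natural] of (h, N). *)
Definition hermitian_cubic_alg (R E : comPzRingType)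
    (phi : {rmorphism R -> E}) (star : E -> E) (W : lmodType E)
    (h : W -> W -> E) (natural : W -> W) : star_alg R :=
  @StarAlg R (E * W)%type
    (fun c x => (phi c * x.1, phi c *: x.2))
    (fun x y => (x.1 * y.1 + h x.2 y.2,
                 x.1 *: y.2 + star y.1 *: x.2 + linearize natural x.2 y.2))
    (1, 0)
    (fun x => (star x.1, x.2)).

(* The pair (a, b) stands for a + s_0 b. *)
Definition CD (K : comPzRingType) (J : star_alg K) (theta : J -> J) (mu : K)
    : star_alg K :=
  @StarAlg K (J * J)%type
    (fun c x => (alg_scale c x.1, alg_scale c x.2))
    (fun x y =>
       (alg_mul x.1 y.1 + alg_scale mu (theta (alg_mul x.2 (theta y.2))),
        alg_mul (theta x.1) y.2 + theta (alg_mul (theta x.2) (theta y.1))))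
    (alg_one, 0)
    (fun x => (x.1, - theta x.2)).

Definition cubic_jordan_alg (K : comPzRingType) (V : lmodType K)
    (T : V -> V -> K) (sharp : V -> V) : star_alg K :=
  hermitian_cubic_alg (idfun : {rmorphism K -> K}) idfun T sharp.

Definition cubic_theta (K : comPzRingType) (V : lmodType K)
    (T : V -> V -> K) (sharp : V -> V)
    (x : cubic_jordan_alg T sharp) : cubic_jordan_alg T sharp :=
  (x.1, - x.2).

Arguments cubic_theta {K V} T sharp x.

Definition is_quadratic_extension (K E : comPzRingType)
    (iota : {rmorphism K -> E}) (mu : K) (s0 : E) : Prop :=
  bijective (fun p : K * K => iota p.1 + iota p.2 * s0)
  /\ s0 * s0 = iota mu.

Definition balanced (K E : comPzRingType) (iota : {rmorphism K -> E})
    (V : lmodType K) (M : zmodType) (f : E -> V -> M) : Prop :=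
  [/\ forall a b v, f (a + b) v = f a v + f b v,
      forall a u v, f a (u + v) = f a u + f a v
    & forall a k v, f (a * iota k) v = f a (k *: v)].

(* W = E (x)_K V as a left E-module, [tens a v] being a (x) v. *)
Definition is_tensor_product (K E : comPzRingType) (iota : {rmorphism K -> E})
    (V : lmodType K) (W : lmodType E) (tens : E -> V -> W) : Prop :=
  [/\ balanced iota tens,
      forall a b v, a *: tens b v = tens (a * b) v,
      forall (M : zmodType) (f : E -> V -> M), balanced iota f ->
        exists g : {additive W -> M}, forall a v, g (tens a v) = f a v
    & forall (M : zmodType) (g g' : {additive W -> M}),
        (forall a v, g (tens a v) = g' (tens a v)) -> g =1 g'].

Definition hermitian_extension (K E : comPzRingType)
    (iota : {rmorphism K -> E}) (star : E -> E)
    (V : lmodType K) (W : lmodType E) (tens : E -> V -> W)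
    (T : V -> V -> K) (h : W -> W -> E) : Prop :=
  is_hermitian star h /\ forall u v, h (tens 1 u) (tens 1 v) = iota (T u v).

Definition bi_semilinear_extension (K E : comPzRingType) (star : E -> E)
    (V : lmodType K) (W : lmodType E) (tens : E -> V -> W)
    (cross : V -> V -> V) (dm : W -> W -> W) : Prop :=
  bi_semilinear star dm /\
  forall u v, dm (tens 1 u) (tens 1 v) = tens 1 (cross u v).

Definition cubic_extension (F : fieldType) (K E : comPzRingType)
    (phi : {rmorphism F -> E}) (iota : {rmorphism K -> E})
    (V : lmodType K) (W : lmodType E) (tens : E -> V -> W)
    (NV : V -> K) (N : W -> E) : Prop :=
  cubic_form phi N /\ forall v, N (tens 1 v) = iota (NV v).

(* ((a + v) + s_0 (b + w)) |-> (a + b s_0) + (1 (x) v + s_0 (1 (x) w)) *)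
Definition CD_identification (K E : comPzRingType) (iota : {rmorphism K -> E})
    (s0 : E) (V : lmodType K) (W : lmodType E) (tens : E -> V -> W)
    (x : (K * V) * (K * V)) : E * W :=
  (iota x.1.1 + iota x.2.1 * s0, tens 1 x.1.2 + s0 *: tens 1 x.2.2).

(* Main.v *)
(* On A(h, N) write {x y z} = V_{x,y} z.  The operators V_{x,1} generate all
   V_{x,y} under brackets and sums, so A(h, N) is structurable as soon as each
   V_{x,1}, paired with -V_{1,x}, is a derivation of the triple product.  This is
   immediate for x in E; for x in W it says that left multiplication by x is a
   derivation up to sign.  Pairing that identity with a test vector through the
   nondegenerate form h turns it into scalar identities, which follow from the
   full linearization of the adjoint identity
     (ab)(cd) + (ac)(bd) + (ad)(bc)
       = f(a,b,c) d + f(a,b,d) c + f(a,c,d) b + f(b,c,d) a,   f(x,y,z) = h(x, yz).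
   The linearization holds on V by polarization of v## = N(v) v, and extends to W
   because both sides are E-linear in each argument.  Structurability and the
   centre are then carried over to CD(J, theta, mu) by the isomorphism in (b). *)
Require Import Defs.
From HB Require Import structures.
From mathcomp Require Import all_boot all_algebra.
From mathcomp Require Import ssrAC ring.
Import GRing.Theory.
Local Open Scope ring_scope.

Set Implicit Arguments.
Unset Strict Implicit.
Unset Printing Implicit Defensive.

(** * Derivations of a triple product and the reduction to operators at the unit *)

Section TripleDerivations.
Variables (A : zmodType) (tri : A -> A -> A -> A).

(** The middle slot carries its own operator: the five-linear identity says exactly that [tri x y],
    paired with [fun z => - tri y x z], is such a pair. *)
Definition triple_derivation (D D' : A -> A) : Prop :=
  [/\ {morph D : x y / x + y}, {morph D' : x y / x + y}
    & forall x y z, D (tri x y z) = tri (D x) y z + tri x (D' y) z + tri x y (D z)].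

Hypothesis triDl : forall x x' y z, tri (x + x') y z = tri x y z + tri x' y z.
Hypothesis triDm : forall x y y' z, tri x (y + y') z = tri x y z + tri x y' z.
Hypothesis triDr : forall x y z z', tri x y (z + z') = tri x y z + tri x y z'.

Let triNl x y z : tri (- x) y z = - tri x y z.
Proof.
have tri0 : tri 0 y z = 0 by apply: (addrI (tri 0 y z)); rewrite -triDl !addr0.
by apply/eqP; rewrite -subr_eq0 opprK -triDl addNr tri0.
Qed.
Let triNm x y z : tri x (- y) z = - tri x y z.
Proof.
have tri0 : tri x 0 z = 0 by apply: (addrI (tri x 0 z)); rewrite -triDm !addr0.
by apply/eqP; rewrite -subr_eq0 opprK -triDm addNr tri0.
Qed.
Let triNr x y z : tri x y (- z) = - tri x y z.
Proof.
have tri0 : tri x y 0 = 0 by apply: (addrI (tri x y 0)); rewrite -triDr !addr0.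
by apply/eqP; rewrite -subr_eq0 opprK -triDr addNr tri0.
Qed.

Lemma eq_triple_derivation D1 D1' D2 D2' :
  D1 =1 D2 -> D1' =1 D2' -> triple_derivation D1 D1' -> triple_derivation D2 D2'.
Proof.
move=> e e' [aD aD' der]; split=> [x y|x y|x y z]; first by rewrite -!e aD.
  by rewrite -!e' aD'.
by rewrite -!e -!e' der.
Qed.

Lemma triple_derivationD D1 D1' D2 D2' :
  triple_derivation D1 D1' -> triple_derivation D2 D2' ->
  triple_derivation (fun x => D1 x + D2 x) (fun x => D1' x + D2' x).
Proof.
move=> [a1 a1' d1] [a2 a2' d2]; split=> [x y|x y|x y z].
- by rewrite a1 a2 addrACA.
- by rewrite a1' a2' addrACA.
by rewrite d1 d2 triDl triDm triDr addrACA [in LHS](addrACA (tri (D1 x) y z)).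
Qed.

Lemma triple_derivationN D D' :
  triple_derivation D D' ->
  triple_derivation (fun x => - D x) (fun x => - D' x).
Proof.
move=> [a a' d]; split=> [x y|x y|x y z]; rewrite ?a ?a' ?opprD //.
by rewrite d triNl triNm triNr !opprD.
Qed.

Lemma triple_derivation_bracket D1 D1' D2 D2' :
  triple_derivation D1 D1' -> triple_derivation D2 D2' ->
  triple_derivation (fun x => D1 (D2 x) - D2 (D1 x))
                    (fun x => D1' (D2' x) - D2' (D1' x)).
Proof.
move=> [a1 a1' d1] [a2 a2' d2]; split=> [x y|x y|x y z].
- by rewrite a2 a1 a1 a2 opprD addrACA.
- by rewrite a2' a1' a1' a2' opprD addrACA.
rewrite d2 !a1 !d1 !a2 !d2 triDl triDm triDr triNl triNm triNr.
apply/eqP; rewrite subr_eq; apply/eqP.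
move: (tri (D1 (D2 x)) y z) (tri (D2 (D1 x)) y z) (tri x (D1' (D2' y)) z).
move: (tri x (D2' (D1' y)) z) (tri x y (D1 (D2 z))) (tri x y (D2 (D1 z))).
move=> Q' S S' P P' Q.
(* The terms where the two operators hit different slots already occur on both sides. Writing [P] as
   [P - P' + P'], and likewise for the other two slots, makes the sides equal up to the order of
   their fifteen summands. *)
rewrite -{1}(subrK P' P) -{1}(subrK Q' Q) -{1}(subrK S' S).
rewrite -!(addrA _ P') ?addrA.
by rewrite [LHS](ACl (1*2*7*8*13*14*3*6*11*4*9*12*5*10*15)).
Qed.

Lemma triple_derivation_opp D : {morph D : x y / x + y} ->
  (forall x y z, D (tri x y z) = tri (D x) y z + tri x y (D z) - tri x (D y) z) ->
  triple_derivation D (fun x => - D x).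
Proof.
move=> a d; split=> [//|x y|x y z]; first by rewrite a opprD.
by rewrite d triNm addrAC.
Qed.

(* With T_x = {x e -} and T'_x = {e x -}, the operators V_{x,y} = {x y -} are
   brackets of the T_x, up to further T_x: this reduces the five-linear
   identity to the four-linear hypothesis on the T_x. *)
Lemma triple_identity_of_unit (e : A) (sym skew : A -> Prop) :
  (forall x : A, x *+ 3 = 0 -> x = 0) ->
  (forall x, exists p s, [/\ sym p, skew s & x = p + s]) ->
  (forall p, sym p -> tri p e e = p /\ tri p e =1 tri e p) ->
  (forall s, skew s -> tri s e e = s *+ 3 /\
                       forall z, tri e s z = - tri s e z) ->
  (forall p, sym p -> triple_derivation (tri p e) (fun z => - tri p e z)) ->
  (forall s, skew s -> triple_derivation (tri s e) (tri s e)) ->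
  forall x y z w q,
    tri x y (tri z w q) - tri z w (tri x y q)
    = tri (tri x y z) w q - tri z (tri y x w) q.
Proof.
move=> tor3 split_sym symP skewP der_sym der_skew.
pose derV x y := triple_derivation (tri x y) (fun z => - tri y x z).
have tri3l x y z : tri (x *+ 3) y z = tri x y z *+ 3.
  by rewrite !mulrSr !mulr0n !add0r !triDl.
have tri3m x y z : tri x (y *+ 3) z = tri x y z *+ 3.
  by rewrite !mulrSr !mulr0n !add0r !triDm.
have tri3r x y z : tri x y (z *+ 3) = tri x y z *+ 3.
  by rewrite !mulrSr !mulr0n !add0r !triDr.
(* The relations [tri p e = tri e p] and [tri e s = - tri s e] give both given pairs the shape that
   [derV] asks for. *)
have der_unit x : derV x e.
  have [p [s [pP sP ->]]] := split_sym x.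
  have [_ ps] := symP _ pP; have [_ ss] := skewP _ sP.
  apply: (eq_triple_derivation _ _
    (triple_derivationD (der_sym p pP) (der_skew s sP))) => z.
    by rewrite triDl.
  by rewrite triDm ss ps opprD opprK.
(* Applying the derivation T_p to {x e z} and using T_p e = p gives V_{x,p} = V_{T_p x, e} -
   [T_p, T_x], a combination of pairs already known. *)
have derV_sym x p : sym p -> derV x p.
  move=> pP; have [p1 pe] := symP _ pP; have [_ _ pder] := der_sym p pP.
  apply: (eq_triple_derivation _ _ (triple_derivationD (der_unit (tri p e x))
    (triple_derivationN (triple_derivation_bracket (der_sym p pP) (der_unit x)))))
    => z.
    have := pder x e z; rewrite p1 triNm => ->.
    by rewrite addrK opprB addrC subrK.
  have := pder e x z; rewrite p1 triNm => pder'.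
  by rewrite !triNr !opprK pder' addrK opprB addKr.
(* The same computation with T_s e = 3s gives 3 V_{x,s} = [T_s, T_x] - V_{T_s x, e}; the factor 3 is
   removed at the end by [tor3]. *)
have derV_skew x s : skew s -> derV x s.
  move=> sP; have [s1 se] := skewP _ sP; have [_ _ sder] := der_skew s sP.
  have comp3 z : tri s e (tri x e z) - tri x e (tri s e z)
                 - tri (tri s e x) e z = tri x s z *+ 3.
    by rewrite sder s1 addrK [_ + tri x _ z]addrC addrK tri3m.
  have comp3' z : tri s e (- tri e x z) + tri e x (tri s e z)
                 + tri e (tri s e x) z = - tri s x z *+ 3.
    rewrite triNr sder s1 !opprD subrK subrK tri3l mulNrn //.
  have [_ _ der3] := triple_derivationD
     (triple_derivation_bracket (der_skew s sP) (der_unit x))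
     (triple_derivationN (der_unit (tri s e x))).
  split=> [y z|y z|y z w]; [by rewrite triDr | by rewrite triDr opprD |].
  apply/eqP; rewrite -subr_eq0; apply/eqP/tor3.
  have := der3 y z w; rewrite !comp3 !opprK !comp3' tri3l tri3m tri3r => e3.
  by rewrite mulrnBl !mulrnDl e3 subrr.
move=> x y z w q.
have [_ _ der] : derV x y.
  have [p [s [pP sP ->]]] := split_sym y.
  apply: (eq_triple_derivation _ _
    (triple_derivationD (derV_sym x p pP) (derV_skew x s sP))) => {}z.
    by rewrite triDm.
  by rewrite triDl opprD.
by rewrite der triNm addrK.
Qed.
End TripleDerivations.

Lemma triple_additive (R : pzRingType) (A : star_alg R) : is_star_algebra A ->
  [/\ forall x x' y z : A, triple (x + x') y z = triple x y z + triple x' y z,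
      forall x y y' z : A, triple x (y + y') z = triple x y z + triple x y' z
    & forall x y z z' : A, triple x y (z + z') = triple x y z + triple x y z'].
Proof.
case=> _ [mDl mDr _ _] _ [sD _ _ _].
split=> *; rewrite /triple ?sD !(mDl, mDr) ?sD ?(mDl, mDr) opprD !addrA;
  by rewrite [LHS](ACl (1*3*5*2*4*6)).
Qed.

(** Turns an equality of vectors into scalar equalities, which [ring] can decide. *)
Lemma nondegenerate_test (E : comPzRingType) (star : E -> E) (W : lmodType E)
    (h : W -> W -> E) : is_hermitian star h -> is_nondegenerate h ->
  forall u v, (forall p, h p u = h p v) -> u = v.
Proof.
case=> _ hD _ _ _ h_nd u v huv; apply/eqP; rewrite -subr_eq0; apply/eqP/h_nd => p.
by apply: (addIr (h p v)); rewrite -hD subrK add0r.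
Qed.

(** * Structurability and centre of A(h, N), from the linearized adjoint identity *)

Section HermitianCubic.
Variables (R E : comPzRingType) (phi : {rmorphism R -> E}).
Variables (star : {rmorphism E -> E}) (W : lmodType E).
Variables (h : W -> W -> E) (dm : W -> W -> W) (natural : W -> W).
Hypothesis starK : involutive star.
Hypothesis h_herm : is_hermitian star h.
Hypothesis h_nondeg : is_nondegenerate h.
Hypothesis dm_semi : bi_semilinear star dm.
Hypothesis dmC : forall u v, dm u v = dm v u.
Hypothesis h_dmCA : forall u v w, h u (dm v w) = h v (dm u w).
Hypothesis quartic : forall a b c d,
  dm (dm a b) (dm c d) + dm (dm a c) (dm b d) + dm (dm a d) (dm b c)
  = h a (dm b c) *: d + h a (dm b d) *: c
    + h a (dm c d) *: b + h b (dm c d) *: a.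
Hypothesis dmE : forall u v, linearize natural u v = dm u v.

Local Notation B := (hermitian_cubic_alg phi star h natural).

Let hDl u u' v : h (u + u') v = h u v + h u' v.
Proof. by case: h_herm. Qed.
Let hDr u v v' : h u (v + v') = h u v + h u v'.
Proof. by case: h_herm. Qed.
Let hZl a u v : h (a *: u) v = a * h u v.
Proof. by case: h_herm. Qed.
Let hZr a u v : h u (a *: v) = star a * h u v.
Proof. by case: h_herm. Qed.
Let h_sym u v : h v u = star (h u v).
Proof. by case: h_herm. Qed.
Let dmDl u u' v : dm (u + u') v = dm u v + dm u' v.
Proof. by case: dm_semi. Qed.
Let dmDr u v v' : dm u (v + v') = dm u v + dm u v'.
Proof. by case: dm_semi. Qed.
Let dmZl a u v : dm (a *: u) v = star a *: dm u v.
Proof. by case: dm_semi. Qed.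
Let dmZr a u v : dm u (a *: v) = star a *: dm u v.
Proof. by case: dm_semi. Qed.
Let hNl u v : h (- u) v = - h u v.
Proof. by rewrite -scaleN1r hZl mulN1r. Qed.
Let hNr u v : h u (- v) = - h u v.
Proof. by rewrite -scaleN1r hZr rmorphN1 mulN1r. Qed.
Let dmNl u v : dm (- u) v = - dm u v.
Proof. by rewrite -scaleN1r dmZl rmorphN1 scaleN1r. Qed.
Let dmNr u v : dm u (- v) = - dm u v.
Proof. by rewrite -scaleN1r dmZr rmorphN1 scaleN1r. Qed.

Let hermitian_test := nondegenerate_test h_herm h_nondeg.

(* Brings every term of degree five into the shape [h b ((p a) (c d))], to which
   [quartic] applies. *)
Lemma h_nested p a b c d :
  h p (dm a (dm b (dm c d))) = star (h b (dm (dm p a) (dm c d))).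
Proof.
by rewrite [dm a _]dmC h_dmCA h_sym h_dmCA.
Qed.

(** By the symmetry of [h x (dm y z)], a nested term of degree four becomes a pairing of two
    products. *)
Lemma h_quartic a b c d : h a (dm b (dm c d)) = h (dm c d) (dm a b).
Proof. by rewrite [dm b _]dmC h_dmCA. Qed.

Lemma mulE (x y : B) :
  alg_mul x y = (x.1 * y.1 + h x.2 y.2,
                 x.1 *: y.2 + star y.1 *: x.2 + dm x.2 y.2).
Proof. by rewrite /= dmE. Qed.

Let h_dml u v w : h (dm u v) w = star (h w (dm u v)).
Proof. exact: h_sym. Qed.

Lemma pair_addrB (U U' : zmodType) (x y z : U * U') :
  x + y - z = (x.1 + y.1 - z.1, x.2 + y.2 - z.2).
Proof. by []. Qed.

(** The three scalars built from all of [u], [v] and [t] coincide by the symmetry of [h x (dm y z)];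
    they carry the signs +, +, -, so a single one survives. *)
Lemma tripleE a u b v c t :
  triple ((a, u) : B) (b, v) (c, t) =
  (a * star b * c *+ 2 - star a * b * c
   + a * h v t + b * h u t + c * h v u + star (h u (dm v t)),
   (star a * b + h u v) *: t + (star c * a - h t u) *: v
   + (star c * b + h t v) *: u + star c *: dm u v + star a *: dm v t
   + star b *: dm u t + dm (dm u v) t + dm (dm t v) u - dm (dm t u) v).
Proof.
rewrite /triple !mulE pair_addrB /= !starK; congr pair.
  rewrite !hDl !hZl !h_dml [dm t v]dmC [h t (dm u v)]h_dmCA [dm t v]dmC.
  rewrite [dm t u]dmC [h v (dm u t)]h_dmCA.
  ring.
apply: hermitian_test => p; rewrite !(dmDl, dmZl) !(hDr, hNr, hZr).
rewrite [dm t v]dmC [dm v u]dmC [dm t u]dmC !(rmorphD, rmorphN, rmorphM) !starK.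
ring.
Qed.

(** The scalar component comes from the symmetry of [h x (dm y z)] and conjugation, the vector
    component from [quartic]. *)
Lemma mul_vector_derivation (r : W) (x y z : B) :
  alg_mul ((0, r) : B) (triple x y z)
  = triple (alg_mul ((0, r) : B) x) y z + triple x y (alg_mul ((0, r) : B) z)
    - triple x (alg_mul ((0, r) : B) y) z.
Proof.
have rE a u : alg_mul ((0, r) : B) (a, u) = (h r u, star a *: r + dm r u).
  by rewrite mulE /= mul0r add0r scale0r add0r.
case: x y z => [a u] [b v] [c t].
rewrite !(rE, tripleE) pair_addrB /=; congr pair.
  rewrite !(dmDl, dmDr, dmZl, dmZr) !(hDl, hDr, hNl, hNr, hZl, hZr).
  rewrite !(rmorphD, rmorphN, rmorphM) !starK.
  rewrite !(dmC u r, dmC v r, dmC t r, dmC v u, dmC t u, dmC t v).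
  rewrite ?(h_sym r u, h_sym r v, h_sym r t, h_sym u v, h_sym u t, h_sym v t).
  rewrite ?(h_dmCA u r, h_dmCA v r, h_dmCA t r).
  rewrite ?(dmC u r, dmC v r, dmC t r, dmC v u, dmC t u, dmC t v).
  rewrite ?(h_dml _ _ u, h_dml _ _ v, h_dml _ _ t, h_dml _ _ r).
  rewrite ?(h_dmCA u r, h_dmCA v r, h_dmCA t r, h_dmCA v u, h_dmCA t u).
  rewrite !(dmC u r, dmC v r, dmC t r, dmC v u, dmC t u, dmC t v).
  rewrite ?starK.
  (* Up to conjugation, the terms of degree four are now the pairings of two products given by the
     three ways to split {r,u,v,t} into pairs; one representative of each is chosen. *)
  rewrite !(dmC (dm _ _) u, dmC (dm _ _) v, dmC (dm _ _) t) !h_quartic.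
  rewrite !(h_sym (dm r t) (dm u v), h_sym (dm r u) (dm v t)).
  rewrite !(h_sym (dm r v) (dm u t)).
  by rewrite ?starK; ring.
apply: hermitian_test => p.
rewrite !(dmDl, dmDr, dmNr, dmZl, dmZr) !(hDr, hNr, hZr).
rewrite !(rmorphD, rmorphN, rmorphM) /= !starK !(hDl, hZl).
(* The quartic identity, solved for one of its three products so that it can be used as a rewrite
   rule. The coefficients are conjugated because [h] is semilinear in its second argument. *)
have Q x a0 b0 c0 d0 : h x (dm (dm a0 b0) (dm c0 d0)) =
  star (h a0 (dm b0 c0)) * h x d0 + star (h a0 (dm b0 d0)) * h x c0
  + star (h a0 (dm c0 d0)) * h x b0 + star (h b0 (dm c0 d0)) * h x a0
  - h x (dm (dm a0 c0) (dm b0 d0)) - h x (dm (dm a0 d0) (dm b0 c0)).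
  have := congr1 (h x) (quartic a0 b0 c0 d0).
  rewrite !hDr !hZr => e.
  by rewrite -e; ring.
rewrite !(dmC u r, dmC v r, dmC t r, dmC v u, dmC t u, dmC t v).
rewrite ?(dmC (dm _ _) u, dmC (dm _ _) v, dmC (dm _ _) t, dmC (dm _ _) r).
rewrite !h_nested !(h_quartic p r, h_quartic p u, h_quartic p v, h_quartic p t).
rewrite !(dmC (dm u v) (dm r t), dmC (dm v t) (dm r u), dmC (dm u t) (dm r v)).
(* After testing against [p], the terms of degree five cancel by the quartic
   identity for {r,u,v,t} and, with [p] in place of t, v and u in turn, by the
   conjugate of that identity. *)
rewrite (Q p r u v t) (Q t p r u v) (Q v p r u t) (Q u p r v t).
rewrite ?(h_sym r u, h_sym r v, h_sym r t, h_sym u v, h_sym u t, h_sym v t).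
rewrite ?(h_sym p r, h_sym p u, h_sym p v, h_sym p t).
rewrite ?(dmC t v).
rewrite ?(h_dmCA u r, h_dmCA v r, h_dmCA t r).
rewrite ?(dmC u r, dmC v r, dmC t r, dmC v u, dmC t u, dmC t v).
rewrite ?(h_dml _ _ u, h_dml _ _ v, h_dml _ _ t, h_dml _ _ r).
rewrite ?(h_dmCA u r, h_dmCA v r, h_dmCA t r, h_dmCA v u, h_dmCA t u).
rewrite ?(dmC u r, dmC v r, dmC t r, dmC v u, dmC t u, dmC t v).
rewrite !(rmorphB, rmorphD, rmorphM) !starK.
ring.
Qed.

Hypothesis star_phi : forall c, star (phi c) = phi c.
Variables half third : R.
Hypothesis half2 : half *+ 2 = 1.
Hypothesis third3 : third *+ 3 = 1.

Let h0l u : h 0 u = 0.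
Proof. by rewrite -[0](scale0r 0) hZl mul0r. Qed.
Let h0r u : h u 0 = 0.
Proof. by rewrite h_sym h0l rmorph0. Qed.
Let dm0l u : dm 0 u = 0.
Proof. by rewrite -[0](scale0r 0) dmZl rmorph0 !scale0r. Qed.
Let dm0r u : dm u 0 = 0.
Proof. by rewrite dmC dm0l. Qed.

Lemma hermitian_cubic_star_algebra : is_star_algebra B.
Proof.
split.
- split=> [[a u]|a b [c u]|a b [c u]|a [b u] [c v]] /=.
  + by rewrite rmorph1 mul1r scale1r.
  + by rewrite rmorphM mulrA scalerA.
  + by rewrite rmorphD mulrDl scalerDl.
  + by rewrite mulrDr scalerDr.
- split=> [[a u] [b v] [c w]|[a u] [b v] [c w]|k [a u] [b v]|k [a u] [b v]];
  rewrite !mulE /=; congr pair.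
  + by rewrite hDl mulrDl addrACA.
  + by apply: hermitian_test => p; rewrite dmDl !(hDr, hZr) rmorphD; ring.
  + by rewrite hDr mulrDr addrACA.
  + by apply: hermitian_test => p; rewrite dmDr !(hDr, hZr) !rmorphD starK; ring.
  + by rewrite hZl mulrDr mulrA.
  + apply: hermitian_test => p; rewrite dmZl !(hDr, hZr) !rmorphM.
    by rewrite !star_phi starK; ring.
  + by rewrite hZr mulrDr mulrCA star_phi.
  + apply: hermitian_test => p; rewrite dmZr !(hDr, hZr) !rmorphM ?starK !star_phi.
    by rewrite ?starK; ring.
- case=> a u; split; rewrite mulE /=.
    by rewrite h0l dm0l mul1r scale1r scaler0 !addr0.
  by rewrite h0r dm0r rmorph1 mulr1 scale1r scaler0 add0r !addr0.
- split=> [[a u] [b v]|k [a u]|[a u] [b v]|[a u]]; rewrite ?mulE /= ?starK //.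
  + by rewrite rmorphD.
  + by rewrite rmorphM star_phi.
  by rewrite rmorphD rmorphM -h_sym mulrC dmC [a *: v + _]addrC.
Qed.

(** A symmetric scalar moves out of every slot of the triple product, so each of the three terms on
    the right equals [D (triple x y z)], with signs +, +, -. *)
Lemma scale_sym_derivation (a : E) (x y z : B) : star a = a ->
  let D (x : B) : B := (a * x.1, a *: x.2) in
  D (triple x y z) = triple (D x) y z + triple x y (D z) - triple x (D y) z.
Proof.
move=> aS D; case: x y z => [b u] [c v] [d t].
rewrite /D !tripleE pair_addrB /=; congr pair.
  rewrite !(hZl, dmZl, dmZr, hZr) !(rmorphM, aS); ring.
apply: hermitian_test => p.
rewrite !(hDr, hNr, hZr, hZl, dmZl, dmZr) /=.
by rewrite !(rmorphD, rmorphB, rmorphN, rmorphM, starK, aS); ring.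
Qed.

(** Here [D] is {a 1 -}, that is z -> az + 2za; on vectors right multiplication by [a] is
    [star a = - a], whence 3a on [E] and -a on [W]. In every term of [tripleE] the weights of the
    three arguments, with a sign for each conjugation, add up to 3a in the scalar and to -a in the
    vector component. *)
Lemma scale_skew_derivation (a : E) (x y z : B) : star a = - a ->
  let D (x : B) : B := (a * x.1 *+ 3, - (a *: x.2)) in
  D (triple x y z) = triple (D x) y z + triple x (D y) z + triple x y (D z).
Proof.
move=> aS D; case: x y z => [b u] [c v] [d t].
rewrite /D !tripleE; congr pair => /=.
  rewrite !(hNl, hNr, dmNl, dmNr, hZl, dmZl, dmZr, hZr).
  by rewrite !(rmorphN, rmorphMn, rmorphM, aS); ring.
apply: hermitian_test => p.
rewrite !(hDr, hNr, hZr, hZl, dmZl, dmZr, hNl, dmNl, dmNr) /=.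
by rewrite !(rmorphD, rmorphB, rmorphM, rmorphN, rmorphMn, starK, aS); ring.
Qed.

Lemma hermitian_cubic_structurable : structurable B.
Proof.
split; first exact: hermitian_cubic_star_algebra.
have [_ [_ mulDr _ _] _ _] := hermitian_cubic_star_algebra.
have [triDl triDm triDr] := triple_additive hermitian_cubic_star_algebra.
have tor3 (M : lmodType E) (m : M) : m *+ 3 = 0 -> m = 0.
  move=> m3; rewrite -[m]scale1r -(rmorph1 phi) -third3 rmorphMn /=.
  by rewrite -scalerMnl scalerMnr m3 scaler0.
have split_half (x : E) : x = phi half * (x + star x) + phi half * (x - star x).
  rewrite -mulrDr addrACA subrr addr0 mulrDr -mulrDl -mulr2n.
  by rewrite -rmorphMn half2 rmorph1 mul1r.
have symE a u c t : star a = a ->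
    triple ((a, u) : B) (1, 0) (c, t) = alg_mul ((a, u) : B) (c, t).
  move=> aS; rewrite tripleE mulE /= !(h0l, h0r, dm0l, dm0r, rmorph1, rmorph0).
  rewrite aS; congr pair; first by ring.
  by rewrite !scaler0 !mulr1 scale1r !(addr0, subr0).
have skewE a c t : star a = - a ->
    triple ((a, 0) : B) (1, 0) (c, t) = (a * c *+ 3, - (a *: t)).
  move=> aS; rewrite tripleE /= !(h0l, h0r, dm0l, dm0r, rmorph1, rmorph0).
  rewrite aS; congr pair; first by ring.
  apply: hermitian_test => p; rewrite !(hDr, hNr, hZr, h0r).
  by rewrite !(rmorphB, rmorphD, rmorphM, rmorph1, rmorph0, rmorphN, aS); ring.
(* The involution fixes [W] pointwise, so the skew elements are the skew scalars. On these {s 1 -}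
   is the operator of [scale_skew_derivation], while for symmetric p the operator {p 1 -} is left
   multiplication by p. *)
apply: (@triple_identity_of_unit _ (@triple _ B) triDl triDm triDr ((1, 0) : B)
         (fun p => star p.1 = p.1) (fun s => star s.1 = - s.1 /\ s.2 = 0)).
- move=> [a u]; rewrite !mulrS mulr0n => e3.
  (* Viewing [E] as a module over itself lets [tor3] treat the scalar component too. *)
  have a3 : (a : E^o) *+ 3 = 0.
    by rewrite !mulrS mulr0n; exact: (congr1 fst e3).
  have u3 : u *+ 3 = 0 by rewrite !mulrS mulr0n; exact: (congr1 snd e3).
  by rewrite (tor3 _ _ a3 : a = 0) (tor3 _ _ u3).
- case=> a u; exists (phi half * (a + star a), u), (phi half * (a - star a), 0).
  split=> /=.
  + by rewrite rmorphM rmorphD star_phi starK addrC.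
  + by rewrite rmorphM rmorphB star_phi starK -mulrN opprB.
  + by congr pair; [exact: split_half | rewrite addr0].
- case=> a u /= aS; split.
    by rewrite symE // mulE /= h0r dm0r rmorph1 mulr1 scaler0 scale1r add0r !addr0.
  case=> c t; rewrite symE // mulE tripleE /=.
  rewrite !(h0l, h0r, dm0l, dm0r, rmorph1, rmorph0) aS; congr pair; first by ring.
  apply: hermitian_test => p; rewrite !(hDr, hNr, hZr, h0r).
  by rewrite !(rmorphB, rmorphD, rmorphM, rmorph1, rmorph0) aS; ring.
- case=> [a u] /= [aS ->]; split.
    rewrite skewE // mulr1 scaler0 oppr0 !mulrS !mulr0n.
    by congr pair; rewrite /= !addr0.
  case=> c t; rewrite skewE // tripleE /=.
  rewrite !(h0l, h0r, dm0l, dm0r, rmorph1, rmorph0) aS.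
  congr pair => /=; first by ring.
  apply: hermitian_test => p; rewrite !(hDr, hNr, hZr, h0r).
  by rewrite !(rmorphB, rmorphD, rmorphM, rmorph1, rmorph0, rmorphN, aS); ring.
- case=> a u /= aS.
  (* Left multiplication by a symmetric element splits into its vector part [L] and its scalar part
     [D], each of which is a derivation up to sign. *)
  pose L (x : B) : B := alg_mul ((0, u) : B) x.
  pose D (x : B) : B := (a * x.1, a *: x.2).
  have LDE z : triple ((a, u) : B) (1, 0) z = L z + D z.
    case: z => c t; rewrite symE // /L !mulE /=; congr pair.
      by rewrite mul0r add0r [RHS]addrC.
    by rewrite scale0r add0r [RHS]addrC addrA.
  have dL : triple_derivation (@triple _ B) L (fun z => - L z).
    apply: (triple_derivation_opp triDm) => [x y|x y z]; first by rewrite /L mulDr.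
    exact: mul_vector_derivation.
  have dD : triple_derivation (@triple _ B) D (fun z => - D z).
    apply: (triple_derivation_opp triDm) => [x y|x y z].
      by rewrite /D mulrDr scalerDr.
    exact: scale_sym_derivation.
  apply: (eq_triple_derivation _ _ (triple_derivationD triDl triDm triDr dL dD)) => z.
    by rewrite LDE.
  by rewrite LDE opprD.
- case=> a u /= [aS ->].
  pose D (x : B) : B := (a * x.1 *+ 3, - (a *: x.2)).
  have DE z : triple ((a, 0) : B) (1, 0) z = D z by case: z => c t; rewrite skewE.
  apply: (@eq_triple_derivation _ _ D D) => //.
  have DD : {morph D : x y / x + y}.
    by move=> x y; rewrite /D mulrDr mulrnDl scalerDr opprD.
  split=> // x y z; exact: scale_skew_derivation.
Qed.

(** Commuting with an invertible skew scalar [s] forces 2sx = 0 for the vector part x, hence x = 0.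
    Conversely, a symmetric scalar moves out of every product. *)
Lemma hermitian_cubic_centre (s s' : E) : s * s' = 1 -> star s = - s ->
  forall z : B, in_centre z <-> star z.1 = z.1 /\ z.2 = 0.
Proof.
move=> ss' sS [e x]; split=> [[/(congr1 fst)/= eS zC]|[/= eS ->]].
  split=> //=; have [/(congr1 snd) c _ _ _] := zC ((s, 0) : B) 0.
  move: c; rewrite /alg_comm !mulE /= !(scaler0, dm0l, dm0r, addr0, add0r) sS.
  rewrite scaleNr -opprD => /eqP; rewrite oppr_eq0 => /eqP c.
  rewrite -[x]scale1r -(rmorph1 phi) -half2 rmorphMn -[phi half *+ 2]mulr1 -ss'.
  rewrite (_ : _ * _ = phi half * s' * (s *+ 2)); last by ring.
  by rewrite -scalerA -scalerMnl mulr2n c scaler0.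
split; first by rewrite /= eS.
have eL u : alg_mul ((e, 0) : B) u = (e * u.1, e *: u.2).
  by rewrite mulE /= h0l dm0l scaler0 !addr0.
have eR u : alg_mul u ((e, 0) : B) = (e * u.1, e *: u.2).
  by rewrite mulE /= h0r dm0r scaler0 add0r !addr0 eS mulrC.
case=> [a u] [b v]; split; apply/eqP; rewrite subr_eq0; apply/eqP.
- by rewrite eL eR.
- rewrite !eL !mulE /=; congr pair.
    by rewrite hZl; ring.
  apply: hermitian_test => p; rewrite dmZl !(hDr, hNr, hZr) !rmorphM !eS; ring.
- rewrite eR eL !mulE /=; congr pair.
    by rewrite hZl hZr eS; ring.
  apply: hermitian_test => p.
  by rewrite dmZl dmZr !(hDr, hNr, hZr) !rmorphM !eS; ring.
- rewrite !eR !mulE /=; congr pair.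
    by rewrite hZr eS; ring.
  apply: hermitian_test => p; rewrite dmZr !(hDr, hNr, hZr) !rmorphM !eS; ring.
Qed.

End HermitianCubic.

(** * Transport of structurability and of the centre along isomorphisms *)

(** The axioms of [is_star_algebra] are pulled back as well, through the injectivity of [f]; only
    its values need to be known to lie in an algebra with involution. *)
Lemma star_alg_iso_structurable (R : pzRingType) (A B : star_alg R) (f : A -> B) :
  star_alg_iso f -> structurable B -> structurable A.
Proof.
case=> fbij fD fZ fM [f1 fS].
have fI := bij_inj fbij.
have f0 : f 0 = 0 by apply: (addrI (f 0)); rewrite -fD !addr0.
have fN x : f (- x) = - f x.
  by apply/eqP; rewrite -addr_eq0 -fD addNr f0.
case=> [[[s1 sM sDl sDr] [mDl mDr mZl mZr] m1 [sD sZ sMul sK]] str].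
have fT x y z : f (triple x y z) = triple (f x) (f y) (f z).
  by rewrite /triple !fD fN !fM !fS.
have fB x y : f (x - y) = f x - f y by rewrite fD fN.
split; last by move=> *; apply: fI; rewrite [LHS]fB [RHS]fB !fT; exact: str.
split.
- split=> *; apply: fI; rewrite ?(fZ, fD, s1, sM, sDl, sDr) //.
- split=> *; apply: fI; rewrite ?(fZ, fD, fM, mDl, mDr, mZl, mZr) //.
- by move=> x; split; apply: fI; rewrite fM f1; case: (m1 (f x)).
- split=> [*|*|*|x]; apply: fI; rewrite ?(fZ, fD, fM, fS, sD, sZ, sMul, sK, fM) //.
Qed.

Lemma star_alg_iso_centre (R : pzRingType) (A B : star_alg R) (f : A -> B) :
  star_alg_iso f -> forall z, in_centre z <-> in_centre (f z).
Proof.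
case=> fbij fD fZ fM [f1 fS] z.
have fI := bij_inj fbij.
have f0 : f 0 = 0 by apply: (addrI (f 0)); rewrite -fD !addr0.
have fN x : f (- x) = - f x.
  by apply/eqP; rewrite -addr_eq0 -fD addNr f0.
have fC x y : f (alg_comm x y) = alg_comm (f x) (f y).
  by rewrite /alg_comm fD fN !fM.
have fA x y t : f (alg_assoc x y t) = alg_assoc (f x) (f y) (f t).
  by rewrite /alg_assoc fD fN !fM.
have [g fK gK] := fbij.
split=> [[zS zC]|[zS zC]]; split.
- by rewrite -fS zS.
- move=> x y; have [c1 c2 c3 c4] := zC (g x) (g y).
  by rewrite -(gK x) -(gK y) -fC -!fA c1 c2 c3 c4.
- by apply: fI; rewrite fS.
move=> x y; have [c1 c2 c3 c4] := zC (f x) (f y).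
by split; apply: fI; rewrite ?fC ?fA f0.
Qed.

(** * Polarization of symmetric multilinear maps without 2- and 3-torsion *)

Section Polarization.
Variables (V : zmodType) (K : comPzRingType).
Hypothesis tor2 : forall c : K, c *+ 2 = 0 -> c = 0.
Hypothesis tor3 : forall c : K, c *+ 3 = 0 -> c = 0.

(** Adding the diagonal values at x + y and x - y leaves 6 f(x,y,y); linearizing f(x,y,y) = 0 in y
    then costs a factor 2. *)
Lemma cubic_polarization (f : V -> V -> V -> K) :
  (forall x y z, f y x z = f x y z) -> (forall x y z, f x z y = f x y z) ->
  (forall x x' y z, f (x + x') y z = f x y z + f x' y z) ->
  (forall v, f v v v = 0) -> forall x y z, f x y z = 0.
Proof.
move=> s12 s23 fD1 f0.
have fD2 x y y' z : f x (y + y') z = f x y z + f x y' z.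
  by rewrite s12 fD1 !(s12 x).
have fD3 x y z z' : f x y (z + z') = f x y z + f x y z'.
  by rewrite s23 fD2 !(s23 x y).
have fN1 x y z : f (- x) y z = - f x y z.
  have fz : f 0 y z = 0 by apply: (addrI (f 0 y z)); rewrite -fD1 !addr0.
  by apply/eqP; rewrite -addr_eq0 -fD1 addNr fz.
have fN2 x y z : f x (- y) z = - f x y z by rewrite s12 fN1 s12.
have fN3 x y z : f x y (- z) = - f x y z by rewrite s23 fN2 s23.
have fxyy x y : f x y y = 0.
  apply/tor3/tor2; have := f0 (x - y); have := f0 (x + y).
  rewrite !(fD1, fD2, fD3, fN1, fN2, fN3) !f0 !(s12 x y, s23 x x y, s23 y x y).
  move=> e1 e2.
  by apply: (etrans _ (etrans (congr2 +%R e1 e2) (addr0 0))); ring.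
move=> x y z; apply: tor2; have := fxyy x (y + z).
by rewrite fD2 !fD3 !fxyy (s23 x y z) add0r addr0 mulr2n.
Qed.

(** Adding the diagonal values at x + y and x - y leaves 12 f(x,x,y,y); the two repeated arguments
    are then linearized in turn, each at the cost of a factor 2. *)
Lemma quartic_polarization (f : V -> V -> V -> V -> K) :
  (forall x y z w, f y x z w = f x y z w) ->
  (forall x y z w, f x z y w = f x y z w) ->
  (forall x y z w, f x y w z = f x y z w) ->
  (forall x x' y z w, f (x + x') y z w = f x y z w + f x' y z w) ->
  (forall v, f v v v v = 0) -> forall x y z w, f x y z w = 0.
Proof.
move=> s12 s23 s34 fD1 f0.
have fD2 x y y' z w : f x (y + y') z w = f x y z w + f x y' z w.
  by rewrite s12 fD1 !(s12 x).
have fD3 x y z z' w : f x y (z + z') w = f x y z w + f x y z' w.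
  by rewrite s23 fD2 !(s23 x y).
have fD4 x y z w w' : f x y z (w + w') = f x y z w + f x y z w'.
  by rewrite s34 fD3 !(s34 x y z).
have fN1 x y z w : f (- x) y z w = - f x y z w.
  have fz : f 0 y z w = 0 by apply: (addrI (f 0 y z w)); rewrite -fD1 !addr0.
  by apply/eqP; rewrite -addr_eq0 -fD1 addNr fz.
have fN2 x y z w : f x (- y) z w = - f x y z w by rewrite s12 fN1 s12.
have fN3 x y z w : f x y (- z) w = - f x y z w by rewrite s23 fN2 s23.
have fN4 x y z w : f x y z (- w) = - f x y z w by rewrite s34 fN3 s34.
have fxxyy x y : f x x y y = 0.
  apply/tor3/tor2/tor2; have := f0 (x - y); have := f0 (x + y).
  rewrite !(fD1, fD2, fD3, fD4, fN1, fN2, fN3, fN4) !f0.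
  rewrite !(s12 x y, (fun a => s23 a x y), (fun a b => s34 a b x y)).
  move=> e1 e2.
  by apply: (etrans _ (etrans (congr2 +%R e1 e2) (addr0 0))); ring.
have fxzyy x z y : f x z y y = 0.
  apply: tor2; have := fxxyy (x + z) y.
  by rewrite fD1 !fD2 !fxxyy (s12 x z) add0r addr0 mulr2n.
move=> x y z w; apply: tor2; have := fxzyy x y (z + w).
by rewrite fD3 !fD4 !fxzyy (s34 x y z w) add0r addr0 mulr2n.
Qed.
End Polarization.

Lemma natr_torsion_free (F : fieldType) (K : comPzRingType)
    (phi : {rmorphism F -> K}) (M : lmodType K) (n : nat) :
  n%:R != 0 :> F -> forall m : M, m *+ n = 0 -> m = 0.
Proof.
move=> n0 m mn; rewrite -[m]scale1r -(rmorph1 phi) -(mulVf n0) mulr_natr.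
by rewrite rmorphMn -scalerMnl scalerMnr mn scaler0.
Qed.

(** * The cubic form on V and the full linearization of its adjoint identity *)

Section CubicNorm.
Variables (F : fieldType) (K : comPzRingType) (phi : {rmorphism F -> K}).
Hypotheses (n2 : 2%:R != 0 :> F) (n3 : 3%:R != 0 :> F).
Variables (V : lmodType K) (NV : V -> K) (T : V -> V -> K) (sharp : V -> V).
Hypothesis T_bilinear : is_hermitian idfun T.
Hypothesis T_nondegenerate : is_nondegenerate T.
Hypothesis T_NV_adjoint : adjoint_identity phi T NV sharp.
Variable cross : V -> V -> V.
Hypothesis crossE : forall u v, linearize sharp u v = cross u v.

Let TDr u v v' : T u (v + v') = T u v + T u v'.
Proof. by case: T_bilinear. Qed.
Let TDl u u' v : T (u + u') v = T u v + T u' v.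
Proof. by case: T_bilinear. Qed.
Let TZr a u v : T u (a *: v) = a * T u v.
Proof. by case: T_bilinear. Qed.
Let TNr u v : T u (- v) = - T u v.
Proof. by rewrite -scaleN1r TZr mulN1r. Qed.

Let bilinear_test := nondegenerate_test T_bilinear T_nondegenerate.

(** Linearizing the adjoint relation for [sharp v] in [v] gives the formula for [cross]. As [sharp]
    is a priori a bare map, the bilinearity of [cross] is obtained from the trilinearity of [f] and
    the nondegeneracy of [T]. *)
Lemma cross_trilinear :
  exists f, cubic_form_of phi f NV /\
    (forall x u v, T x (cross u v) = f x u v) /\
    forall x v, T x (sharp v) = phi 2%:R^-1 * f x v v.
Proof.
have [[f fN fsharp] _] := T_NV_adjoint; exists f; split=> //; split=> // x u v.
have [[s12 s23 fDZ] _] := fN.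
have fD1 a b c d : f (a + b) c d = f a c d + f b c d.
  by rewrite -[a]scale1r fDZ mul1r scale1r.
have fD2 a b c d : f a (b + c) d = f a b d + f a c d.
  by rewrite s12 fD1 !(s12 a).
have fD3 a b c d : f a b (c + d) = f a b c + f a b d.
  by rewrite s23 fD2 !(s23 a b).
rewrite -crossE /linearize !TDr !TNr -!fsharp !(fD2, fD3) (s23 x u v).
have half2 : phi 2%:R^-1 * 2 = 1.
  by rewrite -(rmorph_nat phi) -rmorphM mulVf // rmorph1.
by rewrite -[RHS]mul1r -half2; ring.
Qed.

Lemma crossC u v : cross u v = cross v u.
Proof. by rewrite -!crossE /linearize [v + u]addrC addrAC. Qed.

Lemma bilinear_crossCA u v w : T u (cross v w) = T v (cross u w).
Proof. by have [f [[[s12 _ _] _] [fE _]]] := cross_trilinear; rewrite !fE s12. Qed.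

Lemma crossDl u u' v : cross (u + u') v = cross u v + cross u' v.
Proof.
apply: bilinear_test => x; have [f [[[s12 _ fDZ] _] [fE _]]] := cross_trilinear.
by rewrite TDr !fE -[u]scale1r s12 fDZ mul1r scale1r !(s12 x).
Qed.

Lemma cross0l v : cross 0 v = 0.
Proof. by apply: (addrI (cross 0 v)); rewrite -crossDl !addr0. Qed.

Lemma crossZl k u v : cross (k *: u) v = k *: cross u v.
Proof.
apply: bilinear_test => x; have [f [[[s12 _ fDZ] _] [fE _]]] := cross_trilinear.
have fx0 : f 0 x v = 0 by rewrite s12 -fE cross0l -[0](scale0r 0) TZr mul0r.
by rewrite TZr !fE -[k *: u]addr0 s12 fDZ fx0 addr0 (s12 x).
Qed.

Lemma sharpE v : sharp v = phi 2%:R^-1 *: cross v v.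
Proof.
apply: bilinear_test => x; have [f [_ [fE fsharp]]] := cross_trilinear.
by rewrite TZr fsharp fE.
Qed.

Lemma normE v : NV v = phi 6%:R^-1 * T v (cross v v).
Proof. by have [f [[_ fN] [fE _]]] := cross_trilinear; rewrite fN fE. Qed.

Lemma cross_quartic a b c d :
  cross (cross a b) (cross c d) + cross (cross a c) (cross b d)
  + cross (cross a d) (cross b c)
  = T a (cross b c) *: d + T a (cross b d) *: c
    + T a (cross c d) *: b + T b (cross c d) *: a.
Proof.
apply: bilinear_test => r; apply/eqP; rewrite -subr_eq0 -TNr -TDr; apply/eqP.
have half2 : phi 2%:R^-1 * 2 = 1.
  by rewrite -(rmorph_nat phi) -rmorphM mulVf // rmorph1.
have n6 : 6%:R != 0 :> F by rewrite -[6%N]/(2 * 3)%N natrM mulf_neq0.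
have sixth6 : phi 6%:R^-1 * 6 = 1.
  by rewrite -(rmorph_nat phi) -rmorphM mulVf // rmorph1.
(* With [r] fixed, the defect of the identity is a symmetric quadrilinear form, so it is enough to
   show that it vanishes on the diagonal. *)
pose G a b c d := T r (cross (cross a b) (cross c d)
  + cross (cross a c) (cross b d) + cross (cross a d) (cross b c)
  - (T a (cross b c) *: d + T a (cross b d) *: c
    + T a (cross c d) *: b + T b (cross c d) *: a)).
rewrite -/(G a b c d).
have Tor n : n%:R != 0 :> F -> forall x : K, x *+ n = 0 -> x = 0.
  by move=> n0; apply: (@natr_torsion_free F K phi K^o n n0).
have Tcross := bilinear_crossCA.
apply: (quartic_polarization (Tor _ n2) (Tor _ n3)) => {a b c d}
  [a b c d|a b c d|a b c d|a a' b c d|v]; rewrite /G.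
- rewrite (crossC b a) (Tcross b a c) (Tcross b a d) !(TDr, TNr, TZr).
  by rewrite (crossC (cross b c)) (crossC (cross b d)); ring.
- rewrite (crossC c b) (Tcross c b d) !(TDr, TNr, TZr).
  by ring.
- rewrite (crossC d c) !(TDr, TNr, TZr).
  by ring.
- rewrite !crossDl !(TDr, TNr, TZr, TDl); ring.
(* On the diagonal the claim is 3 (v x v) x (v x v) = 4 T(v, v x v) v. Since v# is half of v x v and
   N(v) is a sixth of T(v, v x v), this is 24 times v## = N(v) v. *)
- have [_ /(_ v)/(congr1 (T r))] := T_NV_adjoint.
  rewrite normE !sharpE !(crossZl, crossC (cross v v) (_ *: _)).
  rewrite !(TDr, TNr, TZr).
  move: half2 sixth6 (T r _) (T v _) (T r v).
  move: (phi _) (phi _) => s h h2 s6 X t R e.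
  have -> : X + X + X = (h * 2) ^+ 3 * (X *+ 3) by rewrite h2 expr1n mul1r; ring.
  have -> : (h * 2) ^+ 3 * (X *+ 3) = (h * (h * (h * X))) *+ 24 by ring.
  by rewrite e -[t * R]mul1r -s6; ring.
Qed.

End CubicNorm.

(** * Extension of T, the cross product and the cubic form from V to W *)

Section Extension.
Variables (K E : comPzRingType) (iota : {rmorphism K -> E}).
Variables (mu : K) (s0 : E).
Hypothesis E_def : is_quadratic_extension iota mu s0.
Variable star : {rmorphism E -> E}.
Hypothesis starK : involutive star.
Hypothesis star_linear : forall k a, star (iota k * a) = iota k * star a.
Hypothesis star_s0 : star s0 = - s0.
Variables (V : lmodType K) (W : lmodType E) (tens : E -> V -> W).
Hypothesis W_def : is_tensor_product iota tens.
Variables (T : V -> V -> K) (cross : V -> V -> V).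
Hypothesis T_bilinear : is_hermitian idfun T.
Hypothesis T_nondegenerate : is_nondegenerate T.
Hypothesis crossC : forall u v, cross u v = cross v u.
Hypothesis crossDl : forall u u' v, cross (u + u') v = cross u v + cross u' v.
Hypothesis crossZl : forall k u v, cross (k *: u) v = k *: cross u v.
Hypothesis T_crossCA : forall u v w, T u (cross v w) = T v (cross u w).
Hypothesis cross_quartic : forall a b c d,
  cross (cross a b) (cross c d) + cross (cross a c) (cross b d)
  + cross (cross a d) (cross b c)
  = T a (cross b c) *: d + T a (cross b d) *: c
    + T a (cross c d) *: b + T b (cross c d) *: a.

Local Notation j := (tens 1).
Let mk (p : K * K) : E := iota p.1 + iota p.2 * s0.
Let mk_inj : injective mk.
Proof. by case: E_def => /bij_inj. Qed.
Let s0_sq : iota mu = s0 * s0.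
Proof. by case: E_def. Qed.

Lemma star_iota k : star (iota k) = iota k.
Proof. by rewrite -[iota k]mulr1 star_linear rmorph1. Qed.

Lemma jD u v : j (u + v) = j u + j v.
Proof. by case: W_def => -[]. Qed.

Lemma tensE a b v : tens (iota a + iota b * s0) v = j (a *: v) + s0 *: j (b *: v).
Proof.
case: W_def => -[tDl _ tB] tZ _ _; rewrite tDl tZ mulr1 [_ * s0]mulrC tB.
by rewrite -{1}[iota a]mul1r tB.
Qed.

Lemma jZ k v : j (k *: v) = iota k *: j v.
Proof. by case: W_def => -[_ _ <-] -> _ _; rewrite mul1r mulr1. Qed.

Let j0 : j 0 = 0.
Proof. by rewrite -[0](scale0r 0) jZ rmorph0 scale0r. Qed.

(** Freeness of [E] over [K] gives W = V + s_0 V as a direct sum: the coordinate map comes from the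
    existence clause of the universal property, and the reconstruction of [w] from its uniqueness
    clause. *)
Lemma tensor_coordinates : exists pi : {additive W -> V * V},
  (forall w, w = j (pi w).1 + s0 *: j (pi w).2) /\
  forall u v, pi (j u + s0 *: j v) = (u, v).
Proof.
case: E_def => -[g mkK gK] _.
have gD a b : g (a + b) = g a + g b.
  apply: mk_inj; rewrite /mk gK /= !rmorphD mulrDl addrACA.
  by rewrite -/(mk (g a)) -/(mk (g b)) /mk !gK.
have gZ a k : g (a * iota k) = ((g a).1 * k, (g a).2 * k).
  apply: mk_inj; rewrite /mk gK /= !rmorphM -{1}[a]gK /=; ring.
case: (W_def) => -[tDl tDr tB] tZ tE tU.
have [|pi piE] := tE _ (fun a v => ((g a).1 *: v, (g a).2 *: v) : V * V).
  split=> *; first by rewrite gD /= !scalerDl.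
    by rewrite !scalerDr.
  by rewrite gZ /= !scalerA.
exists pi; have pij u v : pi (j u + s0 *: j v) = (u, v).
  rewrite tZ mulr1 raddfD !piE.
  have -> : g 1 = (1, 0) by rewrite -(mkK (1, 0)) /= rmorph1 rmorph0 mul0r addr0.
  have -> : g s0 = (0, 1) by rewrite -(mkK (0, 1)) /= rmorph1 rmorph0 mul1r add0r.
  by rewrite /= !scale1r !scale0r; congr pair; rewrite ?addr0 ?add0r.
split=> // w.
pose r x : W := j (pi x).1 + s0 *: j (pi x).2.
have rD : {morph r : x y / x + y}.
  by move=> x y; rewrite /r raddfD /= !tDr scalerDr addrACA.
have r0 : r 0 = 0 by apply: (addrI (r 0)); rewrite -rD !addr0.
have rtens a v : r (tens a v) = tens a v.
  by rewrite /r piE /= -tensE; congr (tens _ v); exact: (gK a).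
(* The map [r] agrees with the identity on pure tensors; uniqueness applies once [r] is packed as an
   additive map. *)
pose rA : {additive W -> W} :=
  HB.pack r (GRing.isNmodMorphism.Build W W r (r0, rD)).
by rewrite -[LHS]/((idfun : {additive W -> W}) w); exact/esym/(tU W rA idfun).
Qed.

Variable pi : {additive W -> V * V}.
Hypothesis piE : forall w, w = j (pi w).1 + s0 *: j (pi w).2.
Hypothesis pij : forall u v, pi (j u + s0 *: j v) = (u, v).

Lemma mkP e : exists a b, e = iota a + iota b * s0.
Proof. by case: E_def => -[g _ gK] _; exists (g e).1, (g e).2; rewrite gK. Qed.

Lemma mk_eq0 a b : iota a + iota b * s0 = 0 -> a = 0 /\ b = 0.
Proof.
move=> e0; have /mk_inj[] // : mk (a, b) = mk (0, 0).
by rewrite /mk e0 /= !rmorph0 mul0r addr0.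
Qed.

Let TDl u u' v : T (u + u') v = T u v + T u' v.
Proof. by case: T_bilinear. Qed.
Let TDr u v v' : T u (v + v') = T u v + T u v'.
Proof. by case: T_bilinear. Qed.
Let TZl a u v : T (a *: u) v = a * T u v.
Proof. by case: T_bilinear. Qed.
Let TZr a u v : T u (a *: v) = a * T u v.
Proof. by case: T_bilinear. Qed.
Let TC u v : T v u = T u v.
Proof. by case: T_bilinear. Qed.

Lemma jN v : j (- v) = - j v.
Proof. by rewrite -scaleN1r jZ rmorphN1 scaleN1r. Qed.

Lemma scale_coordinates a b u v :
  (iota a + iota b * s0) *: (j u + s0 *: j v)
  = j (a *: u + (mu * b) *: v) + s0 *: j (b *: u + a *: v).
Proof.
rewrite !jD !jZ rmorphM s0_sq scalerDl !scalerDr !scalerA.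
rewrite [X in _ + X = _]addrC addrACA [X in _ + X = _]addrC.
by congr (_ + _ *: _ + (_ *: _ + _ *: _)); ring.
Qed.

Lemma pi_scale a b w :
  pi ((iota a + iota b * s0) *: w)
  = (a *: (pi w).1 + (mu * b) *: (pi w).2, b *: (pi w).1 + a *: (pi w).2).
Proof. by rewrite {1}(piE w) scale_coordinates pij. Qed.

Section Hermitian.
Variable h : W -> W -> E.
Hypothesis h_ext : hermitian_extension iota star tens T h.

(** This formula gives uniqueness of the extension, and its right-hand side, read in coordinates,
    serves as the definition in the existence proof. *)
Lemma hermitian_extensionE u v u' v' :
  h (j u + s0 *: j v) (j u' + s0 *: j v')
  = iota (T u u') + s0 * iota (T v u') - s0 * iota (T u v')
    - s0 * s0 * iota (T v v').
Proof.
have [[hDl hDr hZl hZr _] hj] := h_ext.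
by rewrite hDl !hDr !hZl !hZr star_s0 !hj; ring.
Qed.

Lemma hermitian_extension_nondegenerate : is_nondegenerate h.
Proof.
(* Testing against vectors of [V] alone is enough: [h (j x) w] has the coordinates T(x, w_1) and
   -T(x, w_2) in the basis 1, s_0. *)
move=> w hw; have e x : T x (pi w).1 = 0 /\ T x (pi w).2 = 0.
  have := hw (j x + s0 *: j 0); rewrite {1}(piE w) hermitian_extensionE.
  have T0 y : T 0 y = 0 by rewrite -[0](scale0r 0) TZl mul0r.
  rewrite !T0 rmorph0 !mulr0 addr0 subr0 -mulrN mulrC -rmorphN.
  by case/mk_eq0 => -> /eqP; rewrite oppr_eq0 => /eqP.
rewrite (piE w) (T_nondegenerate (u := (pi w).1)) => [|x]; last by case: (e x).
rewrite (T_nondegenerate (u := (pi w).2)) => [|x]; last by case: (e x).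
by rewrite j0 scaler0 addr0.
Qed.
End Hermitian.

Lemma hermitian_extension_unique h h' :
  hermitian_extension iota star tens T h ->
  hermitian_extension iota star tens T h' -> h' =2 h.
Proof.
by move=> hh hh' u v; rewrite (piE u) (piE v) !hermitian_extensionE.
Qed.

Lemma hermitian_extension_exists : exists h, hermitian_extension iota star tens T h.
Proof.
pose h w w' := iota (T (pi w).1 (pi w').1) + s0 * iota (T (pi w).2 (pi w').1)
   - s0 * iota (T (pi w).1 (pi w').2) - s0 * s0 * iota (T (pi w).2 (pi w').2).
exists h; split; last first.
  have T0 y : T 0 y = 0 by rewrite -[0](scale0r 0) TZl mul0r.
  have T0r y : T y 0 = 0 by rewrite TC T0.
  have pj u : pi (j u) = (u, 0).
    rewrite -[j u]addr0 -(scaler0 _ s0).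
    by rewrite -{1}j0 pij.
  by move=> u v; rewrite /h !pj /= T0 !T0r rmorph0 !mulr0 !subr0 addr0.
split.
- by move=> u u' v; rewrite /h raddfD /= !TDl !rmorphD; ring.
- by move=> u v v'; rewrite /h raddfD /= !TDr !rmorphD; ring.
- move=> e u v; have [a [b ->]] := mkP e.
  rewrite /h !pi_scale /= !(TDl, TZl) !rmorphD !rmorphM s0_sq.
  by ring.
- move=> e u v; have [a [b ->]] := mkP e.
  rewrite rmorphD rmorphM star_s0 !star_iota.
  rewrite /h !pi_scale /= !(TDr, TZr) !rmorphD !rmorphM s0_sq.
  by ring.
- move=> u v; rewrite /h !(rmorphD, rmorphB, rmorphN, rmorphM) star_s0 !star_iota.
  by rewrite !(TC _ (_ v)); ring.
Qed.

Let test := nondegenerate_test T_bilinear T_nondegenerate.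
Let crossZr k u v : cross u (k *: v) = k *: cross u v.
Proof. by rewrite crossC crossZl !(crossC u). Qed.
Let TNr u v : T u (- v) = - T u v.
Proof. by rewrite -scaleN1r TZr mulN1r. Qed.

(** Each factor s_0 leaves the product as -s_0: one of them changes the sign, two give s_0^2 =
    [mu]. *)
Lemma bi_semilinear_extensionE dm :
  bi_semilinear_extension star tens cross dm -> forall u v u' v',
  dm (j u + s0 *: j v) (j u' + s0 *: j v')
  = j (cross u u' + mu *: cross v v') + s0 *: j (- (cross v u' + cross u v')).
Proof.
case=> -[dDl dDr dZl dZr] dj u v u' v'.
rewrite dDl !dDr !dZl !dZr star_s0 !dj jD jZ jN jD s0_sq !scaleNr !scalerN opprK.
rewrite scalerA scalerDr opprD.
by rewrite [X in _ + X = _]addrC addrACA [X in _ + X = _]addrC.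
Qed.

Lemma bi_semilinear_extension_unique dm dm' :
  bi_semilinear_extension star tens cross dm ->
  bi_semilinear_extension star tens cross dm' -> dm' =2 dm.
Proof.
by move=> hd hd' u v; rewrite (piE u) (piE v) !bi_semilinear_extensionE.
Qed.

Lemma bi_semilinear_extension_exists :
  exists dm, bi_semilinear_extension star tens cross dm.
Proof.
pose X w w' := cross (pi w).1 (pi w').1 + mu *: cross (pi w).2 (pi w').2.
pose Y w w' := - (cross (pi w).2 (pi w').1 + cross (pi w).1 (pi w').2).
have XC w w' : X w w' = X w' w.
  by rewrite /X !(crossC _ (pi w').1) !(crossC _ (pi w').2).
have YC w w' : Y w w' = Y w' w.
  by rewrite /Y addrC !(crossC _ (pi w').1) !(crossC _ (pi w').2).
pose dm w w' := j (X w w') + s0 *: j (Y w w').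
have dmC w w' : dm w w' = dm w' w by rewrite /dm XC YC.
have dmDl u u' v : dm (u + u') v = dm u v + dm u' v.
  rewrite /dm addrACA -scalerDr -!jD; congr (j _ + s0 *: j _); apply: test => x;
    rewrite /X /Y raddfD /= !crossDl ?opprD !(TDr, TZr, TNr); ring.
have dmZl e u v : dm (e *: u) v = star e *: dm u v.
  have [a [b ->]] := mkP e.
  rewrite rmorphD rmorphM star_s0 !star_iota mulrN -mulNr -rmorphN.
  rewrite /dm scale_coordinates; congr (j _ + s0 *: j _); apply: test => x;
    rewrite /X /Y !pi_scale /=;
    by rewrite !(crossDl, crossZl) !(TDr, TZr, TNr); ring.
exists dm; split; first split=> //.
- by move=> u v v'; rewrite dmC dmDl !(dmC u).
- by move=> e u v; rewrite dmC dmZl !(dmC u).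
have pj u : pi (j u) = (u, 0) by rewrite -[j u]addr0 -(scaler0 _ s0) -{1}j0 pij.
have cross0 u : cross u 0 = 0 by rewrite -[0](scale0r 0) crossZr !scale0r.
move=> u v; rewrite /dm /X /Y !pj /= (crossC 0) !cross0.
by rewrite scaler0 !addr0 oppr0 j0 scaler0 addr0.
Qed.

(** Reduces an identity on [W] to [V], one variable at a time. Leaving [c] free covers linear maps
    (c = s_0) and semilinear ones (c = -s_0). *)
Lemma semilinear_vanish (g : W -> E) (c : E) :
  {morph g : x y / x + y} -> (forall x, g (s0 *: x) = c * g x) ->
  (forall v, g (j v) = 0) -> forall w, g w = 0.
Proof.
by move=> gD gZ gj w; rewrite (piE w) gD gZ !gj mulr0 addr0.
Qed.

Section Structure.
Variables (h : W -> W -> E) (dm : W -> W -> W).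
Hypothesis h_ext : hermitian_extension iota star tens T h.
Hypothesis dm_ext : bi_semilinear_extension star tens cross dm.

Let hDl u u' v : h (u + u') v = h u v + h u' v.
Proof. by case: h_ext => -[]. Qed.
Let hDr u v v' : h u (v + v') = h u v + h u v'.
Proof. by case: h_ext => -[]. Qed.
Let hZl a u v : h (a *: u) v = a * h u v.
Proof. by case: h_ext => -[]. Qed.
Let hZr a u v : h u (a *: v) = star a * h u v.
Proof. by case: h_ext => -[]. Qed.
Let hNr u v : h u (- v) = - h u v.
Proof. by rewrite -scaleN1r hZr rmorphN1 mulN1r. Qed.
Let hj u v : h (j u) (j v) = iota (T u v).
Proof. by case: h_ext. Qed.
Let dmDl u u' v : dm (u + u') v = dm u v + dm u' v.
Proof. by case: dm_ext => -[]. Qed.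
Let dmZl a u v : dm (a *: u) v = star a *: dm u v.
Proof. by case: dm_ext => -[]. Qed.
Let dmj u v : dm (j u) (j v) = j (cross u v).
Proof. by case: dm_ext. Qed.

Lemma extension_dmC u v : dm u v = dm v u.
Proof.
rewrite (piE u) (piE v) !bi_semilinear_extensionE //.
by rewrite !(crossC (pi v).1) !(crossC (pi v).2) [X in - X]addrC.
Qed.
Let dmC := extension_dmC.
Let dmDr u v v' : dm u (v + v') = dm u v + dm u v'.
Proof. by rewrite dmC dmDl !(dmC u). Qed.
Let dmZr a u v : dm u (a *: v) = star a *: dm u v.
Proof. by rewrite dmC dmZl !(dmC u). Qed.

(** In each variable the conjugations of [h] and [dm] cancel, so both sides are [E]-linear in all
    three and may be compared on [V]. *)
Lemma extension_dmCA u v w : h u (dm v w) = h v (dm u w).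
Proof.
apply/eqP; rewrite -subr_eq0; apply/eqP; move: w.
apply: (@semilinear_vanish
  (fun w => h u (dm v w) - h v (dm u w)) s0) => [x y|x|w] /=.
- by rewrite !dmDr !hDr; ring.
- by rewrite !dmZr !hZr !starK mulrBr.
move: v; apply: (@semilinear_vanish
  (fun v => h u (dm v (j w)) - h v (dm u (j w))) s0) => [x y|x|v] /=.
- by rewrite !(dmDl, hDr, hDl); ring.
- by rewrite !dmZl !hZr !hZl !starK mulrBr.
move: u; apply: (@semilinear_vanish
  (fun u => h u (dm (j v) (j w)) - h (j v) (dm u (j w))) s0) => [x y|x|u] /=.
- by rewrite !(dmDl, hDr, hDl); ring.
- by rewrite !dmZl !hZr !hZl !starK mulrBr.
by rewrite !dmj !hj T_crossCA subrr.
Qed.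
Let h_dmCA := extension_dmCA.

Lemma extension_quartic a b c d :
  dm (dm a b) (dm c d) + dm (dm a c) (dm b d) + dm (dm a d) (dm b c)
  = h a (dm b c) *: d + h a (dm b d) *: c
    + h a (dm c d) *: b + h b (dm c d) *: a.
Proof.
apply/eqP; rewrite -subr_eq0; apply/eqP.
apply: (hermitian_extension_nondegenerate h_ext) => p.
pose D a b c d := h p (dm (dm a b) (dm c d) + dm (dm a c) (dm b d)
  + dm (dm a d) (dm b c) - (h a (dm b c) *: d + h a (dm b d) *: c
    + h a (dm c d) *: b + h b (dm c d) *: a)).
rewrite -/(D a b c d).
have s12 x y z w : D y x z w = D x y z w.
  rewrite /D (dmC y x) (h_dmCA y x z) (h_dmCA y x w) !(hDr, hNr, hZr).
  by rewrite (dmC (dm y z)) (dmC (dm y w)); ring.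
have s23 x y z w : D x z y w = D x y z w.
  by rewrite /D (dmC z y) (h_dmCA z y w) !(hDr, hNr, hZr); ring.
have s34 x y z w : D x y w z = D x y z w.
  by rewrite /D (dmC w z) !(hDr, hNr, hZr); ring.
have DD y z w : {morph (fun x => D x y z w) : x x' / x + x'}.
  by move=> x x'; rewrite /D !dmDl !(hDr, hNr, hZr, hDl) !rmorphD; ring.
(* The vector identity is linear in [x]; the pairing with [p] makes it semilinear, hence the factor
   -s_0. The transpositions below bring each variable to the first slot, the only one where this is
   proved. *)
have DZ y z w x : D (s0 *: x) y z w = - s0 * D x y z w.
  rewrite /D !dmZl !(hDr, hNr, hZr, hZl) !rmorphM starK star_s0; ring.
have s13 x y z w : D z y x w = D x y z w by rewrite s12 s23 s12.
have s14 x y z w : D w y z x = D x y z w by rewrite s12 s23 s34 s23 s12.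
move: a; apply: (semilinear_vanish (DD _ _ _) (DZ _ _ _)) => a.
rewrite -s12; move: b; apply: (semilinear_vanish (DD _ _ _) (DZ _ _ _)) => b.
rewrite -s13; move: c; apply: (semilinear_vanish (DD _ _ _) (DZ _ _ _)) => c.
rewrite -s14; move: d; apply: (semilinear_vanish (DD _ _ _) (DZ _ _ _)) => d.
rewrite /D !dmj !hj -!jZ -!jD -jN -jD cross_quartic subrr j0.
by rewrite -(scale0r 0) hZr rmorph0 mul0r.
Qed.

Variables (F : fieldType) (phi : {rmorphism F -> K}) (NV : V -> K).
Variable sharp : V -> V.
Hypotheses (n2 : 2%:R != 0 :> F) (n3 : 3%:R != 0 :> F).
Hypothesis normE : forall v, NV v = phi 6%:R^-1 * T v (cross v v).
Hypothesis crossE : forall u v, linearize sharp u v = cross u v.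
Local Notation phiE := (iota \o phi : {rmorphism F -> E}).
Local Notation natural := (fun w => phiE 2%:R^-1 *: dm w w).
Local Notation N := (fun w => phiE 6%:R^-1 * h w (dm w w)).

Let phiEV n : n%:R != 0 :> F -> phiE n%:R^-1 * n%:R = 1.
Proof. by move=> n0; rewrite -(rmorph_nat phiE) -rmorphM mulVf // rmorph1. Qed.
Let n6 : 6%:R != 0 :> F.
Proof. by rewrite -[6%N]/(2 * 3)%N natrM mulf_neq0. Qed.

Lemma extension_linearize u v : linearize natural u v = dm u v.
Proof.
rewrite /linearize dmDl !dmDr (dmC v u) !scalerDr.
set uu := _ *: dm u u; set vv := _ *: dm v v; set uv := _ *: dm u v.
rewrite -addrA -opprD [X in X - _](_ : _ = (uu + vv) + uv *+ 2); last first.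
  by rewrite mulr2n !addrA [LHS](ACl (1*4*2*3)).
by rewrite addrC addKr /uv scalerMnl -mulr_natr phiEV // scale1r.
Qed.

Lemma extension_symmetric_trilinear : symmetric_trilinear (fun x y z => h x (dm y z)).
Proof.
split=> [x y z|x y z|a x x' y z]; first exact: h_dmCA.
  by rewrite dmC.
by rewrite hDl hZl.
Qed.

Lemma extension_cubic : cubic_extension phiE iota tens NV N.
Proof.
split; first by eexists; split; [exact: extension_symmetric_trilinear |].
by move=> v; rewrite dmj hj normE rmorphM.
Qed.

Lemma trilinear_vanish (f : W -> W -> W -> E) :
  symmetric_trilinear f -> (forall u v w, f (j u) (j v) (j w) = 0) ->
  forall x y z, f x y z = 0.
Proof.
case=> s12 s23 fDZ fj x y z.
have fD y' z' : {morph (fun x => f x y' z') : a b / a + b}.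
  by move=> a b; rewrite -[a]scale1r fDZ mul1r scale1r.
have fZ y' z' a : f (s0 *: a) y' z' = s0 * f a y' z'.
  have f0 : f 0 y' z' = 0 by apply: (addrI (f 0 y' z')); rewrite -fD !addr0.
  by rewrite -[s0 *: a]addr0 fDZ f0 addr0.
move: x; apply: (semilinear_vanish (fD _ _) (fZ _ _)) => u.
rewrite -s12; move: y; apply: (semilinear_vanish (fD _ _) (fZ _ _)) => v.
rewrite -s12 -s23 -s12; move: z.
apply: (semilinear_vanish (fD _ _) (fZ _ _)) => w.
exact: fj.
Qed.

(** The trilinear forms of [N'] and [N] agree on [V] by polarization, hence on [W] by
    [E]-linearity. *)
Lemma extension_cubic_unique N' : cubic_extension phiE iota tens NV N' -> N' =1 N.
Proof.
case=> -[f' [tri' N'E]] N'j w; rewrite N'E; congr (_ * _).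
have [s12 s23 hDZ] := extension_symmetric_trilinear.
have [s12' s23' fDZ'] := tri'.
apply/eqP; rewrite -subr_eq0; apply/eqP.
apply: (@trilinear_vanish (fun x y z => f' x y z - h x (dm y z))).
  split=> [x y z|x y z|a x x' y z]; first by rewrite s12' s12.
    by rewrite s23' dmC.
  by rewrite fDZ' hDl hZl; ring.
have Tor n : n%:R != 0 :> F -> forall x : E, x *+ n = 0 -> x = 0.
  by move=> n0; apply: (@natr_torsion_free F E phiE E^o n n0).
apply: (cubic_polarization (Tor _ n2) (Tor _ n3)) => [x y z|x y z|x x' y z|v].
- by rewrite s12' s12.
- by rewrite s23' (dmC (j z)).
- by rewrite jD -[j x]scale1r fDZ' hDl !mul1r scale1r; ring.
- have := N'j v; rewrite N'E normE rmorphM dmj hj; move: (phiEV n6) => /=.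
  move: (f' _ _ _) (iota (T _ _)) (iota (phi _)) => X t sixth s6 e.
  by rewrite -[X - t]mul1r -s6 mulrAC mulrBr e subrr mul0r.
Qed.

Lemma extension_adjoint_identity : adjoint_identity phiE h N natural.
Proof.
split.
  exists (fun x y z => h x (dm y z)).
    by split; [exact: extension_symmetric_trilinear |].
  by move=> u v; rewrite hZr /= star_iota.
move=> v; apply/eqP; rewrite -subr_eq0; apply/eqP.
apply: (hermitian_extension_nondegenerate h_ext) => p.
have /(congr1 (h p)) := extension_quartic v v v v.
rewrite !(dmZl, dmZr) !(hDr, hNr, hZr) !rmorphM /= !star_iota.
move: (phiEV n2) (phiEV n6) => /=; move: (iota _) (iota _) => sixth half h2 s6.
move: (h p _) (star _) (h p v) => X t R e.
(* Inserting 1 = [sixth * 6] on the left and 1 = [(half * 2) ^+ 3] on the right makes the difference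
   a multiple of 3X - 4tR, which vanishes by the quartic identity at v, v, v, v. *)
transitivity (half ^+ 3 * (sixth * 6) * X - sixth * (half * 2) ^+ 3 * t * R).
  by rewrite h2 s6 expr1n; ring.
have -> : half ^+ 3 * (sixth * 6) * X = half ^+ 3 * sixth * 2 * (X + X + X) by ring.
by rewrite e; ring.
Qed.

Lemma CD_identification_iso :
  star_alg_iso
    (A := restrict_scalars phi
       (CD (J := cubic_jordan_alg T sharp) (cubic_theta T sharp) mu))
    (B := hermitian_cubic_alg phiE star h natural)
    (CD_identification iota s0 tens).
Proof.
split.
- have [[g mkK gK] _] := E_def.
  (* The inverse takes coordinates of the [E] part by [g] and of the [W] part by [pi], and regroups
     them. *)
  exists (fun y => (((g y.1).1, (pi y.2).1), ((g y.1).2, (pi y.2).2))).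
    move=> [[a u] [b v]]; rewrite /CD_identification /= pij /=.
    by rewrite -[X in g X]/(mk (a, b)) (mkK (a, b)).
  by move=> [e w]; rewrite /CD_identification /= -piE; congr pair; exact: gK.
- move=> [[a u] [b v]] [[c t] [d w]]; rewrite /CD_identification /=.
  by rewrite !jD !rmorphD scalerDr addrACA; congr pair; rewrite mulrDl addrACA.
- move=> k [[a u] [b v]]; rewrite /CD_identification /=; congr pair.
    by rewrite !rmorphM; ring.
  by rewrite !jZ scalerDr !scalerA mulrC.
- move=> [[a u] [b v]] [[c t] [d w]].
  have idE p q r s : CD_identification iota s0 tens ((p, q), (r, s))
    = (iota p + iota r * s0, j q + s0 *: j s) by [].
  rewrite [RHS](mulE (dm := dm)); last exact: extension_linearize.
  rewrite !idE hermitian_extensionE // bi_semilinear_extensionE //=.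
  have crossNl x y : cross (- x) y = - cross x y.
    by rewrite -scaleN1r crossZl scaleN1r.
  have crossNr x y : cross x (- y) = - cross x y by rewrite crossC crossNl crossC.
  have TNl x y : T (- x) y = - T x y by rewrite -scaleN1r TZl mulN1r.
  rewrite !crossE !(TNl, TNr, crossNl, crossNr); congr pair.
    by rewrite !(rmorphD, rmorphN, rmorphM) s0_sq; ring.
  have -> : star (iota c + iota d * s0) = iota c + iota (- d) * s0.
    by rewrite rmorphD rmorphM !star_iota star_s0 rmorphN mulNr mulrN.
  have jj p q r s : (j p + s0 *: j q) + (j r + s0 *: j s)
                    = j (p + r) + s0 *: j (q + s).
    by rewrite !jD scalerDr addrACA.
  rewrite !scale_coordinates !jj.
  by congr (j _ + s0 *: j _); apply: test => x; rewrite !(TDr, TNr, TZr); ring.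
split.
  by rewrite /CD_identification /= rmorph1 rmorph0 mul0r j0 scaler0 !addr0.
(* The map - theta negates s_0 K and fixes s_0 V, which matches [star] on [E] and the identity on
   [W]. *)
move=> [[a u] [b v]]; rewrite /CD_identification /= opprK; congr pair.
by rewrite rmorphD rmorphM !star_iota star_s0 rmorphN mulrN mulNr.
Qed.
End Structure.
End Extension.

Theorem lemma7p4
  (F : fieldType) (char_neq2 : 2%N \notin [pchar F])
  (char_neq3 : 3%N \notin [pchar F])
  (K : comPzRingType) (phi : {rmorphism F -> K})
  (V : lmodType K) (NV : V -> K) (T : V -> V -> K) (sharp : V -> V)
  (NV_cubic : cubic_form phi NV)
  (T_bilinear : is_hermitian idfun T)
  (T_nondegenerate : is_nondegenerate T)
  (T_NV_adjoint : adjoint_identity phi T NV sharp)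
  (mu : K) (mu_unit : exists nu : K, mu * nu = 1)
  (E : comPzRingType) (iota : {rmorphism K -> E}) (s0 : E)
  (E_def : is_quadratic_extension iota mu s0)
  (star : {rmorphism E -> E}) (star_involutive : involutive star)
  (star_linear : forall (k : K) (a : E), star (iota k * a) = iota k * star a)
  (star_s0 : star s0 = - s0)
  (W : lmodType E) (tens : E -> V -> W)
  (W_def : is_tensor_product iota tens) :
  let phiE : {rmorphism F -> E} := iota \o phi in
  let cross := linearize sharp in
  let CDJ : star_alg F :=
    restrict_scalars phi
      (CD (J := cubic_jordan_alg T sharp) (cubic_theta T sharp) mu) in
  [/\ exists h : W -> W -> E,
        hermitian_extension iota star tens T h /\
        forall h', hermitian_extension iota star tens T h' -> h' =2 h,
      exists dm : W -> W -> W,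
        bi_semilinear_extension star tens cross dm /\
        forall dm', bi_semilinear_extension star tens cross dm' -> dm' =2 dm
    & forall (h : W -> W -> E) (dm : W -> W -> W),
        hermitian_extension iota star tens T h ->
        bi_semilinear_extension star tens cross dm ->
        let natural := fun w : W => phiE (2%:R^-1) *: dm w w in
        let N := fun w : W => phiE (6%:R^-1) * h w (dm w w) in
        [/\ [/\ is_nondegenerate h,
                cubic_extension phiE iota tens NV N,
                forall N', cubic_extension phiE iota tens NV N' -> N' =1 N
              & adjoint_identity phiE h N natural],
            star_alg_iso (A := CDJ)
              (B := hermitian_cubic_alg phiE star h natural)
              (CD_identification iota s0 tens)
          & (forall z : CDJ,
               in_centre z <-> exists k : K, z = ((k, 0), (0, 0)))
            /\ structurable CDJ]].
Proof.
have n2 : 2%:R != 0 :> F by move: char_neq2; rewrite inE.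
have n3 : 3%:R != 0 :> F by move: char_neq3; rewrite inE.
have [nu mu_nu] := mu_unit; have mu_s0 : iota mu = s0 * s0 by case: E_def.
move=> phiE cross CDJ.
have crossE u v : linearize sharp u v = cross u v by [].
have crossC := crossC crossE.
have NV_E : forall v, NV v = phi 6%:R^-1 * T v (cross v v).
  by apply: normE; eassumption.
have crossDl : forall u u' v, cross (u + u') v = cross u v + cross u' v.
  by apply: crossDl; eassumption.
have crossZl : forall k u v, cross (k *: u) v = k *: cross u v.
  by apply: crossZl; eassumption.
have T_crossCA : forall u v w, T u (cross v w) = T v (cross u w).
  by apply: bilinear_crossCA; eassumption.
have quartic : forall a b c d,
    cross (cross a b) (cross c d) + cross (cross a c) (cross b d)
    + cross (cross a d) (cross b c)
    = T a (cross b c) *: d + T a (cross b d) *: c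
      + T a (cross c d) *: b + T b (cross c d) *: a.
  by apply: cross_quartic; eassumption.
have [pi [piE pij]] := tensor_coordinates E_def W_def.
have star_iota := star_iota star_linear.
split.
- have [h h_ext] : exists h, hermitian_extension iota star tens T h.
    by apply: hermitian_extension_exists; eassumption.
  by exists h; split=> // h' h_ext'; apply: hermitian_extension_unique; eassumption.
- have [dm dm_ext] : exists dm, bi_semilinear_extension star tens cross dm.
    by apply: bi_semilinear_extension_exists; eassumption.
  exists dm; split=> // dm' dm_ext'.
  by apply: bi_semilinear_extension_unique; eassumption.
move=> h dm h_ext dm_ext natural N.
have h_nondeg : is_nondegenerate h.
  by apply: hermitian_extension_nondegenerate; eassumption.
have dmC : forall u v, dm u v = dm v u by eapply extension_dmC; eassumption.
have naturalE : forall u v, linearize natural u v = dm u v.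
  by eapply extension_linearize; eassumption.
have iso : star_alg_iso (A := CDJ)
    (B := hermitian_cubic_alg phiE star h natural) (CD_identification iota s0 tens).
  by apply: CD_identification_iso; eassumption.
have half2 : 2%:R^-1 *+ 2 = 1 :> F by rewrite -[LHS]mulr_natr mulVf.
have third3 : 3%:R^-1 *+ 3 = 1 :> F by rewrite -[LHS]mulr_natr mulVf.
have star_phi c : star (phiE c) = phiE c by exact: star_iota.
have [h_herm _] := h_ext; have [dm_semi _] := dm_ext.
split=> //; first split=> //.
- by eapply extension_cubic; eassumption.
- by eapply extension_cubic_unique; eassumption.
- by eapply extension_adjoint_identity; eassumption.
split; last first.
  apply: (star_alg_iso_structurable iso).
  apply: (hermitian_cubic_structurable star_involutive h_herm h_nondeg dm_semi
            dmC _ _ naturalE star_phi half2 third3).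
    by eapply extension_dmCA; eassumption.
  by eapply extension_quartic; eassumption.
(* Since s_0^2 = [mu] is a unit, s_0 is an invertible skew scalar, as the description of the centre
   requires. *)
have s0_unit : s0 * (iota nu * s0) = 1.
  by rewrite mulrCA -mu_s0 -rmorphM mulrC mu_nu rmorph1.
have centreB := hermitian_cubic_centre (phi := phiE) h_herm h_nondeg dm_semi dmC
  naturalE half2 s0_unit star_s0.
move=> [[a u] [b v]]; apply: (iff_trans (star_alg_iso_centre iso _)).
apply: (iff_trans (centreB _)); rewrite /CD_identification /=.
rewrite rmorphD rmorphM !star_iota star_s0; split; last first.
  case=> k [-> -> -> ->]; rewrite rmorph0 !mul0r; split=> //.
  by rewrite [RHS]piE raddf0.
(* Invariance of a + b s_0 under [star] means b s_0 = -b s_0, so 2b = 0 by independence of 1 and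
   s_0, and b = 0. *)
case=> /addrI bs0 uv0; exists a.
have [_ b2] : 0 = 0 :> K /\ b *+ 2 = 0.
  apply: (mk_eq0 E_def); rewrite rmorph0 add0r rmorphMn mulrnAl mulr2n.
  by rewrite -{1}bs0 mulrN addNr.
have -> : b = 0 by apply: (natr_torsion_free phi n2 (M := K^o)).
by have := pij u v; rewrite uv0 raddf0 => -[-> ->].
Qed.
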